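(* Let $m,n\in\mathbb{N}$ with $\max(m,n)>1$, and let $\rho$ and $\sigma$ be norms on $\mathbb{R}^m$ and $\mathbb{R}^n$ respectively. Then the closure of $\mathbb{L}_{\rho,\sigma}$ is equal to the interval $[0,L_{\rho,\sigma}]$. Moreover, for any non-empty open interval $I\subset[0,L_{\rho,\sigma}]$, the set $$\{A\in M_{m,n}(\mathbb{R}) : \lambda_{\rho,\sigma}(A)\in I\}$$ is dense in $M_{m,n}(\mathbb{R})$.
   Context: $M_{m,n}(\mathbb{R})$ is the space of real $m\times n$ matrices with its usual topology. For norms $\rho$ on $\mathbb{R}^m$ and $\sigma$ on $\mathbb{R}^n$ and $A\in M_{m,n}(\mathbb{R})$, the Lagrange constant of $A$ is $$\lambda_{\rho,\sigma}(A):=\liminf_{\mathbf{q}\to\infty,\ \mathbf{q}\in\mathbb{Z}^n}\ \sigma(\mathbf{q})^n\min_{\mathbf{p}\in\mathbb{Z}^m}\rho(A\mathbf{q}-\mathbf{p})^m .$$ The multidimensional Lagrange spectrum is $\mathbb{L}_{\rho,\sigma}:=\{\lambda_{\rho,\sigma}(A): A\in M_{m,n}(\mathbb{R})\}$, and $L_{\rho,\sigma}:=\sup\mathbb{L}_{\rho,\sigma}$, which is finite by Minkowski's Convex Body Theorem. *)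

(* Defs.v *)
From mathcomp Require Import all_boot all_order all_algebra.
From mathcomp Require Import all_classical all_reals all_analysis.
From mathcomp Require Import ring lra zify.

Set Implicit Arguments.
Unset Strict Implicit.
Unset Printing Implicit Defensive.

Import Order.TTheory GRing.Theory Num.Theory.
Import numFieldNormedType.Exports.
Local Open Scope classical_set_scope.
Local Open Scope ring_scope.

(* Nonnegativity follows from the other axioms. *)
Definition is_norm (R : realType) (V : lmodType R) (N : V -> R) : Prop :=
  [/\ forall x y, N (x + y) <= N x + N y,
      forall (a : R) x, N (a *: x) = `|a| * N x
    & forall x, N x = 0 -> x = 0].

Notation intv q := (map_mx intr q).

(* The filter "x --> oo" on R^n. The norm is the sup norm of the library; any
   other norm on R^n gives the same filter. *)
Definition vec_infty (R : realType) (n : nat) : set_system 'cV[R]_n :=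
  filter_from [set: R] (fun M => [set x | M <= `|x|]).
Arguments vec_infty : clear implicits.

Definition integer_vec (R : realType) (n : nat) : set 'cV[R]_n :=
  [set intv q | q in [set: 'cV[int]_n]].
Arguments integer_vec : clear implicits.

Section Lagrange.
Variables (R : realType) (m n : nat).
Variables (rho : 'cV[R]_m -> R) (sigma : 'cV[R]_n -> R).

(* Z^m being discrete and closed in R^m, the infimum over p is a minimum. *)
Definition lagrange_fun (A : 'M[R]_(m, n)) (q : 'cV[R]_n) : R :=
  sigma q ^+ n * inf [set rho (A *m q - p) ^+ m | p in integer_vec R m].

Definition lagrange_liminf (A : 'M[R]_(m, n)) : \bar R :=
  limf_einf (fun q : 'cV[R]_n => (lagrange_fun A q)%:E)
    (within (integer_vec R n) (vec_infty R n)).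

(* For norms rho and sigma and positive m and n the lower limit is finite
   (lagrange_liminf_fin), so that fine loses nothing. *)
Definition lagrange_constant (A : 'M[R]_(m, n)) : R := fine (lagrange_liminf A).

Definition lagrange_spectrum : set R := range lagrange_constant.

(* A genuine supremum by has_sup_lagrange_spectrum. *)
Definition lagrange_sup : R := sup lagrange_spectrum.

End Lagrange.

Section Finiteness.
Variable R : realType.

Lemma is_norm0 (V : lmodType R) (N : V -> R) : is_norm N -> N 0 = 0.
Proof. by case=> _ h _; rewrite -(scale0r 0) h normr0 mul0r. Qed.

Lemma is_norm_ge0 (V : lmodType R) (N : V -> R) x : is_norm N -> 0 <= N x.
Proof.
move=> hN; have [tri hom _] := hN.
have := tri x (- x); rewrite subrr (is_norm0 hN) -scaleN1r hom normrN1 mul1r.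
lra.
Qed.

Lemma is_norm_bound k (N : 'cV[R]_k -> R) : is_norm N ->
  exists2 C, 0 <= C &
    forall (v : 'cV[R]_k) B, (forall i, `|v i ord0| <= B) -> N v <= C * B.
Proof.
move=> hN; have [tri hom _] := hN.
exists (\sum_i N (delta_mx i ord0)) => [|v B vB].
  by apply: sumr_ge0 => i _; exact: is_norm_ge0.
rewrite [v]matrix_sum_delta mulr_suml.
under eq_bigr do rewrite big_ord1.
elim/big_ind2 : _ => [|x1 x2 y1 y2 h1 h2|i _]; first by rewrite (is_norm0 hN).
  exact: le_trans (tri _ _) (lerD h1 h2).
by rewrite hom mulrC ler_wpM2l // is_norm_ge0.
Qed.

Lemma dirichlet m n (A : 'M[R]_(m, n)) (N : nat) : (0 < n)%N -> (0 < N)%N ->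
  exists (q : 'cV[int]_n) (p : 'cV[int]_m),
    [/\ q != 0, forall j, `|q j ord0| <= (N ^ m)%:Z
      & forall i, `|(A *m intv q - intv p) i ord0| * (N ^ n)%:R <= 1].
Proof.
move=> n0 N0.
have aux (a b c : nat) : (a < c.+1)%N -> (b < c.+1)%N -> `|a%:Z - b%:Z| <= c%:Z.
  by rewrite ler_norml; lia.
pose v (x : {ffun 'I_n -> 'I_(N ^ m).+1}) : 'cV[int]_n := \col_j (x j : nat)%:Z.
pose w x i : R := (A *m intv (v x)) i ord0.
pose K : R := (N ^ n)%:R.
have K0 : 0 < K by rewrite ltr0n expn_gt0 N0.
pose g x i : int := Num.floor ((w x i - (Num.floor (w x i))%:~R) * K).
have g0 x i : 0 <= g x i.
  by rewrite floor_ge0 mulr_ge0 ?(ltW K0)// subr_ge0 floor_le.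
have gK x i : (absz (g x i) < N ^ n)%N.
  have : g x i < (N ^ n)%:Z.
    rewrite -(ltr_int R); apply: le_lt_trans (floor_le _) _.
    rewrite -[ltRHS]mul1r ltr_pM2r //.
    have := floorD1_gt (w x i); rewrite intrD; lra.
  by have := g0 x i; lia.
pose G x : {ffun 'I_m -> 'I_(N ^ n)} := [ffun i => Ordinal (gK x i)].
have /injectivePn[x [y xy Gxy]] : ~~ injectiveb G.
  apply/negP => /injectiveP /leq_card.
  rewrite !card_ffun !card_ord -!expnM mulnC expnM leqNgt.
  by rewrite ltn_exp2r ?leqnn.
exists (v x - v y), (\col_i (Num.floor (w x i) - Num.floor (w y i))); split.
- apply: contra_neq xy => /eqP; rewrite subr_eq0 => /eqP /matrixP vxy.
  by apply/ffunP => j; apply/val_inj; have := vxy j ord0; rewrite !mxE => -[].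
- by move=> j; rewrite !mxE; exact: aux (ltn_ord (x j)) (ltn_ord (y j)).
- move=> i.
  have gxy : g x i = g y i.
    have := congr1 (fun h : {ffun 'I_m -> 'I_(N ^ n)} => val (h i)) Gxy.
    by rewrite !ffunE /=; have := g0 x i; have := g0 y i; lia.
  rewrite map_mxB mulmxBr.
  have -> : (A *m intv (v x) - A *m intv (v y) -
      intv (\col_i0 (Num.floor (w x i0) - Num.floor (w y i0)))) i ord0 =
      (w x i - (Num.floor (w x i))%:~R) - (w y i - (Num.floor (w y i))%:~R).
    have entry (a b : 'cV[R]_m) (c : 'cV[int]_m) :
        (a - b - intv c) i ord0 = a i ord0 - b i ord0 - (c i ord0)%:~R.
      by rewrite !mxE.
    by rewrite entry -/(w x i) -/(w y i) mxE intrB; ring.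
  rewrite -/K -[K in X in X <= _](gtr0_norm K0) -normrM mulrBl.
  have := floor_le ((w x i - (Num.floor (w x i))%:~R) * K).
  have := floorD1_gt ((w x i - (Num.floor (w x i))%:~R) * K).
  have := floor_le ((w y i - (Num.floor (w y i))%:~R) * K).
  have := floorD1_gt ((w y i - (Num.floor (w y i))%:~R) * K).
  rewrite -/(g x i) -/(g y i) gxy !intrD ler_norml; lra.
Qed.

Lemma dirichlet_infty m n (A : 'M[R]_(m, n)) (M : nat) :
  (0 < m)%N -> (0 < n)%N -> (0 < M)%N ->
  exists (q : 'cV[int]_n) (p : 'cV[int]_m) (B D : R),
    [/\ (exists j, M%:Z <= `|q j ord0|), 0 <= D,
      forall j, `|(intv q : 'cV[R]_n) j ord0| <= B,
      forall i, `|(A *m intv q - intv p) i ord0| <= D & B ^+ n * D ^+ m <= 1].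
Proof.
move=> m0 n0 M0; have [N NE] : exists N, N = (M ^ (2 * n + m))%N by eexists.
have N0 : (0 < N)%N by rewrite NE expn_gt0 M0.
have [q [p [q0 qN pN]]] := dirichlet A n0 N0.
have K0 : 0 < (N ^ n)%:R :> R by rewrite ltr0n expn_gt0 N0.
have pN' i : `|(A *m intv q - intv p) i ord0| <= ((N ^ n)%:R)^-1.
  by rewrite -[leRHS]mul1r ler_pdivlMr.
have [[j jM]|small] := pselect (exists j, M%:Z <= `|q j ord0|).
  exists q, p, (N ^ m)%:R, ((N ^ n)%:R)^-1; split => //.
  - by exists j.
  - move=> k; rewrite mxE -intr_norm.
    by have := qN k; rewrite -(ler_int R).
  - rewrite exprVn -!natrX -!expnM mulnC mulfV // pnatr_eq0.
    by rewrite -lt0n expn_gt0 N0.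
have qM j : `|q j ord0| <= M%:Z.
  by case: (lerP M%:Z `|q j ord0|) => [h|/ltW //]; case: small; exists j.
exists (M%:Z *: q), (M%:Z *: p), (M ^ 2)%:R, (M%:R * ((N ^ n)%:R)^-1).
have scE (k : nat) (u : 'cV[int]_k) : intv (M%:Z *: u) = M%:R *: (intv u : 'cV[R]_k).
  by apply/matrixP => a b; rewrite !mxE intrM.
split.
- have [j qj] : exists j, q j ord0 != 0.
    apply/existsP; rewrite -[X in is_true X]negbK negb_exists.
    apply: contra q0 => /forallP h.
    apply/eqP/matrixP => a b; rewrite ord1 [RHS]mxE; apply/eqP.
    by have := h a; rewrite negbK.
  exists j; rewrite mxE normrM [X in _ <= X * _]ger0_norm // ler_peMr //.
  by move: (q j ord0) qj => z; lia.
- by rewrite mulr_ge0 // invr_ge0 ltW.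
- move=> j; rewrite mxE -intr_norm mxE normrM.
  have := qM j; rewrite -(ler_int R) intrM => h.
  by rewrite expnS expn1 natrM ler_wpM2l.
- move=> i; rewrite !scE -scalemxAr -scalerBr mxE normrM normr_nat.
  by rewrite ler_wpM2l.
- rewrite exprMn exprVn -!natrX -!expnM mulrA -natrM -expnD.
  rewrite ler_pdivrMr ?ltr0n ?expn_gt0 ?N0 // mul1r ler_nat.
  rewrite -NE -[leqLHS]expn1 leq_pexp2l // ?muln_gt0 ?n0 //.
Qed.

Variables (m n : nat) (m0 : (0 < m)%N) (n0 : (0 < n)%N).
Variables (rho : 'cV[R]_m -> R) (sigma : 'cV[R]_n -> R).
Hypotheses (Hrho : is_norm rho) (Hsigma : is_norm sigma).

Lemma lagrange_liminf_bound : exists C : R, forall A : 'M[R]_(m, n),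
  (0 <= lagrange_liminf rho sigma A <= C%:E)%E.
Proof.
have [Cr Cr0 hr] := is_norm_bound Hrho; have [Cs Cs0 hs] := is_norm_bound Hsigma.
exists (Cs ^+ n * Cr ^+ m) => A; rewrite /lagrange_liminf limf_einfE.
pose S x := [set rho (A *m x - p) ^+ m | p in integer_vec R m].
have S_lb x : lbound (S x) 0.
  by move=> _ [p _ <-]; rewrite exprn_ge0 // is_norm_ge0.
have inf_ge0 x : 0 <= inf (S x).
  by apply: lb_le_inf => //; exists (rho (A *m x - intv 0) ^+ m), (intv 0) => //; exists 0.
apply/andP; split.
  apply: (@le_trans _ _ (ereal_inf [set (lagrange_fun rho sigma A q)%:E | q in setT])).
    apply/le_ereal_inf_tmp => _ [q _ <-]; rewrite lee_fin mulr_ge0 //.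
    - by rewrite exprn_ge0 // is_norm_ge0.
    - exact: inf_ge0.
  apply/ereal_sup_ubound; exists setT => //.
  by exists 0.
apply/ge_ereal_sup => _ [V [M _ MV] <-].
have [q [p [B [D [[j qj] D0 hB hD BD]]]]] :=
  dirichlet_infty A m0 n0 (ltn0Sn (Num.bound `|M|)).
apply: (@le_trans _ _ (lagrange_fun rho sigma A (intv q))%:E).
  apply: ereal_inf_lbound; exists (intv q) => //; apply: MV; last by exists q.
  apply: (@le_trans _ _ `|(intv q : 'cV[R]_n) j ord0|).
    rewrite mxE -intr_norm; apply: (@le_trans _ _ (Num.bound `|M|).+1%:R).
      apply: le_trans (ler_norm _) _; apply: ltW; apply: lt_le_trans.
        exact: archi_boundP (normr_ge0 M).
      by rewrite ler_nat.
    by rewrite pmulrn ler_int.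
  rewrite [leRHS]mx_normrE.
  exact: (le_bigmax _ (fun i => `|(intv q : 'cV[R]_n) i.1 i.2|) (j, ord0)).
have B0 : 0 <= B := le_trans (normr_ge0 _) (hB j).
rewrite lee_fin /lagrange_fun -/(S (intv q)).
apply: (@le_trans _ _ ((Cs * B) ^+ n * (Cr * D) ^+ m)).
  apply: ler_pM => //.
  - by rewrite exprn_ge0 // is_norm_ge0.
  - by rewrite lerXn2r ?nnegrE ?mulr_ge0 ?is_norm_ge0 // hs.
  - apply: (@le_trans _ _ (rho (A *m intv q - intv p) ^+ m)).
      apply: ge_inf; first by exists 0.
      by exists (intv p) => //; exists p.
    by rewrite lerXn2r ?nnegrE ?mulr_ge0 ?is_norm_ge0 // hr.
rewrite !exprMn mulrACA -[leRHS]mulr1 ler_wpM2l //.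
by rewrite mulr_ge0 // exprn_ge0.
Qed.

Lemma lagrange_liminf_fin (A : 'M[R]_(m, n)) :
  lagrange_liminf rho sigma A \is a fin_num.
Proof.
have [C /(_ A)/andP[h0 hC]] := lagrange_liminf_bound.
by rewrite ge0_fin_numE // (le_lt_trans hC) // ltry.
Qed.

Lemma has_sup_lagrange_spectrum : has_sup (lagrange_spectrum rho sigma).
Proof.
split; first by exists (lagrange_constant rho sigma 0), 0.
have [C hC] := lagrange_liminf_bound; exists C => _ [A _ <-].
by rewrite -lee_fin fineK ?lagrange_liminf_fin //; case/andP: (hC A).
Qed.

End Finiteness.

(* Main.v *)
Require Import Defs.
From mathcomp Require Import all_boot all_order all_algebra.
From mathcomp Require Import all_classical all_reals all_analysis.
From mathcomp Require Import perm ring lra zify.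
Import Order.TTheory GRing.Theory Num.Theory.
Import numFieldNormedType.Exports.
Local Open Scope classical_set_scope.
Local Open Scope ring_scope.

Set Implicit Arguments.
Unset Strict Implicit.
Unset Printing Implicit Defensive.

(* An integer matrix W in GL_(m+n)(Z) acts on M_(m,n)(R) by a Moebius map
   A |-> A'. If A' q' - p' and q' are computed from (p, q) through W, then
   A' q' - p' = b (A q - p) and q' = c q - g (A q - p) with |det b det c| = 1,
   so the Lagrange constant of A' is that of A for the norms rho o b and
   sigma o c. For a fixed A the triples (A', b, c), with b and c taken up to
   scalars, are dense as W varies. Hence A' can be chosen near any matrix with a
   Lagrange constant near the normalised Lagrange constant of A for the norms
   rho o B and sigma o C, whatever the invertible B and C. That quantity is
   continuous in (B, C); it is the Lagrange constant of A at (1, 1), and it tends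
   to 0 when B (if m > 1) or C (if n > 1) contracts a limit direction of the
   vectors A q - p (resp. q) of a sequence of good approximations. By the
   intermediate value theorem all values in ]0, lambda(A)] are attained, and
   lambda(A) can be taken close to the supremum. *)

(** * Matrices and norms on R^n *)

Section MatrixNorm.
Variable R : realType.

(** The obstacle is to prescribe b and c, through an integer W, while A is arbitrary. If this is
    asked for every A at once, with A' near 0, the pairs (B, C) that can be approached form a
    closed, multiplicative family, stable under scalars and under GL(Z) on both sides. By the Smith
    normal form it then suffices to approach (1, D) and (D, 1) for D diagonal and positive. The
    pairs (1, D) come from an explicit family of W whose lower right block is Y^m, with Y
    bidiagonal, k a_i on the diagonal and ones below it. As k grows, Y / k tends to the diagonal
    matrix of the a_i, while the ones make the determinant of W equal to 1 or -1. Inverting W and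
    exchanging its blocks gives the pairs (D, 1). The hypothesis max(m, n) > 1 enters through the
    contraction only: shrinking one direction by th costs a factor 1/th in the determinant and gains
    th^m or th^n, which wins as soon as the exponent exceeds 1. *)

Lemma mx_norm_le m n (M : 'M[R]_(m, n)) (e : R) :
  0 <= e -> (forall i j, `|M i j| <= e) -> `|M| <= e.
Proof.
by move=> e0 Me; rewrite [leLHS]mx_normrE; apply: bigmax_le => // -[i j] _; exact: Me.
Qed.

Lemma mx_entry_le m n (M : 'M[R]_(m, n)) i j : `|M i j| <= `|M|.
Proof.
rewrite [leRHS]mx_normrE.
exact: (le_bigmax _ (fun i => `|M i.1 i.2|) (i, j)).
Qed.

Lemma mx_norm_mul m n p (M : 'M[R]_(m, n)) (N : 'M[R]_(n, p)) :
  `|M *m N| <= n%:R * `|M| * `|N|.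
Proof.
apply: mx_norm_le => [|i j]; first by rewrite !mulr_ge0.
rewrite mxE (le_trans (ler_norm_sum _ _ _)) //.
have -> : n%:R * `|M| * `|N| = \sum_(k < n) `|M| * `|N|.
  by rewrite sumr_const card_ord -[RHS]mulr_natl mulrA.
by apply: ler_sum => k _; rewrite normrM ler_pM ?mx_entry_le.
Qed.

Lemma mx_norm_mul_le m n p (M : 'M[R]_(m, n)) (N : 'M[R]_(n, p)) (k x y : R) :
  n%:R <= k -> `|M| <= x -> `|N| <= y -> `|M *m N| <= k * x * y.
Proof.
move=> nk Mx Ny; rewrite (le_trans (mx_norm_mul _ _)) // ler_pM ?mulr_ge0 //.
exact: ler_pM.
Qed.

Lemma mx_norm_mul_near m n p (M : 'M[R]_(m, n)) (N : 'M[R]_(n, p)) (e : R) : 0 < e ->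
  exists2 d : R, 0 < d & forall M' N', `|M' - M| <= d -> `|N' - N| <= d ->
    `|M' *m N' - M *m N| <= e.
Proof.
move=> e0; pose K : R := n%:R * (`|M| + `|N| + 1) + 1.
have K1 : 0 < K by rewrite ltr_wpDl // mulr_ge0 // !addr_ge0.
exists (Num.min 1 (e / K)); first by rewrite lt_min ltr01 divr_gt0.
move=> M' N'; rewrite !le_min => /andP[_ hM] /andP[hN1 hN].
have -> : M' *m N' - M *m N = (M' - M) *m N' + M *m (N' - N).
  by rewrite mulmxBl mulmxBr subrKA.
have nN' : `|N'| <= `|N| + 1.
  by rewrite -(subrK N N') (le_trans (ler_normD _ _)) // addrC lerD2l.
rewrite (le_trans (ler_normD _ _)) //.
apply: (@le_trans _ _ (K * (e / K))); last by rewrite mulrCA divff ?gt_eqF ?mulr1.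
apply: (@le_trans _ _ (n%:R * (e / K) * (`|N| + 1) + n%:R * `|M| * (e / K))).
  have n0 : 0 <= n%:R :> R by [].
  apply: lerD; apply: le_trans (mx_norm_mul _ _) _.
    by rewrite ler_pM ?mulr_ge0 // ler_wpM2l.
  by rewrite ler_wpM2l ?mulr_ge0.
have eK : 0 <= e / K by rewrite divr_ge0 // ltW.
rewrite /K; move: (e / _) eK => t t0; nra.
Qed.

Lemma mx_eq0P m n (M : 'M[R]_(m, n)) : `|M| = 0 -> M = 0.
Proof. by move/eqP; rewrite normr_eq0 => /eqP. Qed.

(** A row space K killed by 1 + E satisfies K = - K E, so its norm is at most half of itself. *)
Lemma unitmx_neumann n (E : 'M[R]_n) : n%:R * `|E| <= 2^-1 ->
  1%:M + E \in unitmx.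
Proof.
move=> hE; rewrite -row_free_unit -kermx_eq0; apply/eqP.
set K := kermx _.
have : K *m (1%:M + E) = 0 by exact: mulmx_ker.
rewrite mulmxDr mulmx1 => /eqP; rewrite addr_eq0 => /eqP KE.
apply: mx_eq0P.
have : `|K| <= 2^-1 * `|K|.
  rewrite {1}KE normrN (le_trans (mx_norm_mul _ _)) //.
  by rewrite mulrAC ler_wpM2r.
by have := normr_ge0 K; lra.
Qed.

(** The inverse Z satisfies Z = 1 - E Z; this bounds [|Z|] by twice the norm of 1, and then Z - 1 =
    - E Z. *)
Lemma invmx_neumann n (E : 'M[R]_n) : n%:R * `|E| <= 2^-1 ->
  `|invmx (1%:M + E) - 1%:M| <= n%:R * `|E| * 2 * `|1%:M : 'M[R]_n|.
Proof.
move=> hE; have U := unitmx_neumann hE; set Z := invmx _.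
have ZE : Z = 1%:M - E *m Z.
  by rewrite -(mulmxV U) -/Z mulmxDl mul1mx addrK.
have EZ : `|E *m Z| <= n%:R * `|E| * `|Z| by exact: mx_norm_mul.
have nZ : `|Z| <= 2 * `|1%:M : 'M[R]_n|.
  have : `|Z| <= `|1%:M : 'M[R]_n| + 2^-1 * `|Z|.
    rewrite {1}ZE (le_trans (ler_normB _ _)) // lerD2l (le_trans EZ) //.
    by rewrite ler_wpM2r.
  lra.
by rewrite {1}ZE addrC addKr normrN (le_trans EZ) // -[leRHS]mulrA ler_wpM2l.
Qed.

Lemma invmx_near n (M : 'M[R]_n) (e : R) : M \in unitmx -> 0 < e ->
  exists2 d : R, 0 < d & forall M', `|M' - M| <= d ->
    M' \in unitmx /\ `|invmx M' - invmx M| <= e.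
Proof.
move=> uM e0.
pose n1 : R := n%:R + 1; have n10 : 0 < n1 by rewrite ltr_wpDl.
have nn1 : n%:R <= n1 by rewrite lerDl.
pose I1 : R := `|1%:M : 'M[R]_n| + 1; have I0 : 0 < I1 by rewrite ltr_wpDl.
pose V : R := `|invmx M| + 1; have V0 : 0 < V by rewrite ltr_wpDl.
pose t := Num.min 2^-1 (e / (n1 * 2 * I1 * V)).
have t0 : 0 < t by rewrite lt_min invr_gt0 ltr0n divr_gt0 // !mulr_gt0.
exists (t / (n1 * n1 * V)); first by rewrite divr_gt0 // !mulr_gt0.
move=> M' hM'; pose E := invmx M *m (M' - M).
have M'E : M' = M *m (1%:M + E).
  by rewrite mulmxDr mulmx1 mulmxA mulmxV // mul1mx subrKC.
have nE : n%:R * `|E| <= t.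
  apply: (@le_trans _ _ (n1 * (n1 * V * (t / (n1 * n1 * V))))); last first.
    by rewrite le_eqVlt; apply/orP; left; apply/eqP; field; rewrite !gt_eqF.
  rewrite ler_pM // (le_trans (mx_norm_mul _ _)) // ler_pM ?mulr_ge0 //.
  by rewrite ler_pM // lerDl.
have hE : n%:R * `|E| <= 2^-1 by rewrite (le_trans nE) // ge_min lexx.
have U := unitmx_neumann hE.
have uM' : M' \in unitmx by rewrite M'E unitmx_mul uM.
split => //.
have -> : invmx M' - invmx M = (invmx (1%:M + E) - 1%:M) *m invmx M.
  rewrite mulmxBl mul1mx; congr (_ - _).
  apply: (can_inj (mulKmx uM')); rewrite mulmxV // M'E.
  by rewrite -mulmxA (mulmxA _ (invmx _)) mulmxV // mul1mx mulmxV.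
rewrite (le_trans (mx_norm_mul _ _)) //.
apply: (@le_trans _ _ (n1 * (t * 2 * I1) * V)).
  rewrite ler_pM ?mulr_ge0 //; last by rewrite lerDl.
  rewrite ler_pM // (le_trans (invmx_neumann hE)) //.
  by rewrite ler_pM ?mulr_ge0 ?lerDl // ler_wpM2r.
have -> : n1 * (t * 2 * I1) * V = t * (n1 * 2 * I1 * V) by ring.
by rewrite -ler_pdivlMr ?mulr_gt0 // ge_min lexx orbT.
Qed.

Lemma prod_near (I : Type) (r : seq I) (F : I -> R) (e : R) : 0 < e ->
  exists2 d : R, 0 < d & forall G, (forall i, `|G i - F i| <= d) ->
    `|\prod_(i <- r) G i - \prod_(i <- r) F i| <= e.
Proof.
elim: r e => [|i r IH] e e0.
  by exists 1 => // G _; rewrite !big_nil subrr normr0 ltW.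
pose K := `|F i| + `|\prod_(i <- r) F i| + 2.
have K0 : 0 < K by rewrite ltr_wpDl // addr_ge0.
have t0 : 0 < Num.min 1 (e / K) by rewrite lt_min ltr01 divr_gt0.
have [d d0 hd] := IH _ t0.
exists (Num.min d (e / K)); first by rewrite lt_min d0 divr_gt0.
move=> G hG; rewrite !big_cons.
have := hG i; rewrite le_min => /andP[_ hGi].
have /hd : forall i, `|G i - F i| <= d.
  by move=> j; have := hG j; rewrite le_min => /andP[].
rewrite le_min => /andP[h1 h2].
move: h1 h2 hGi; rewrite /K; set p := \prod_(i <- r) G i.
set q := \prod_(i <- r) F i => h1 h2 h3.
have -> : G i * p - F i * q = (G i - F i) * p + F i * (p - q) by ring.
have np : `|p| <= `|q| + 1 by rewrite -(subrK q p) (le_trans (ler_normD _ _)) // addrC lerD2l.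
rewrite (le_trans (ler_normD _ _)) // !normrM.
have -> : e = (`|F i| + `|q| + 2) * (e / (`|F i| + `|q| + 2)).
  by rewrite mulrCA divff ?mulr1 // gt_eqF.
move: (e / _) h2 h3 => t.
have := normr_ge0 (G i - F i); have := normr_ge0 p; have := normr_ge0 (F i).
have := normr_ge0 q; have := normr_ge0 (p - q); nra.
Qed.

Lemma det_near n (M : 'M[R]_n) (e : R) : 0 < e ->
  exists2 d : R, 0 < d & forall M', `|M' - M| <= d -> `|\det M' - \det M| <= e.
Proof.
move=> e0; pose K : R := \sum_(s : {perm 'I_n}) 1 + 1.
have K0 : 0 < K by rewrite ltr_wpDl // sumr_ge0.
have /choice[d hd] (s : {perm 'I_n}) : exists d, 0 < d /\ forall M', `|M' - M| <= d ->
    `|\prod_i M' i (s i) - \prod_i M i (s i)| <= e / K.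
  have [|d d0 hd] := @prod_near _ (index_enum 'I_n) (fun i => M i (s i)) (e / K).
    by rewrite divr_gt0.
  exists d; split=> // M' hM'; apply: hd => i.
  by have := mx_entry_le (M' - M) i (s i); rewrite !mxE => /le_trans; exact.
exists (\big[Num.min/1]_s d s).
  by apply: lt_bigmin => // s _; case: (hd s).
move=> M' hM'; rewrite /determinant -sumrB (le_trans (ler_norm_sum _ _ _)) //.
apply: (@le_trans _ _ (\sum_(s : {perm 'I_n}) e / K)).
  apply: ler_sum => s _; rewrite -mulrBr normrM normrX normrN1 expr1n mul1r.
  have [_] := hd s; apply; apply: le_trans hM' _.
  exact: bigmin_le.
under eq_bigr do rewrite -[_ / _]mulr1.
rewrite -mulr_sumr mulrAC -mulrA ger_pMr // ler_pdivrMr // mul1r.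
by rewrite lerDl.
Qed.

Lemma mx_norm_tr m n (M : 'M[R]_(m, n)) : `|M^T| = `|M|.
Proof.
suff h p q (N : 'M[R]_(p, q)) : `|N^T| <= `|N|.
  by apply/eqP; rewrite eq_le h -{1}[M]trmxK h.
by apply: mx_norm_le => // i j; rewrite mxE; exact: mx_entry_le.
Qed.

Lemma is_norm_ge k (N : 'cV[R]_k -> R) : is_norm N ->
  exists2 c : R, 0 < c & forall v, c * `|v| <= N v.
Proof.
move=> hN; have [tri hom sep] := hN.
have [C C0 hC] := is_norm_bound hN.
have NC v : N v <= C * `|v| by apply: hC => i; exact: mx_entry_le.
(* Transposed to row vectors, the setting of [bounded_closed_compact] and [EVT_min_rV]: the constant
   is the minimum of N on the unit sphere. *)
pose f (r : 'rV[R]_k) := N r^T.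
have fL r r' : `|f r - f r'| <= C * `|r - r'|.
  have half a b : f a - f b <= C * `|a - b|.
    rewrite lerBlDr -mx_norm_tr (le_trans _ (lerD (NC _) (lexx _))) //.
    by rewrite (le_trans _ (tri _ _)) // /f !linearB /= subrK.
  by rewrite ler_norml half andbT lerNl opprB distrC half.
have fc : continuous f.
  have C1 : 0 < C + 1 by rewrite ltr_wpDl.
  move=> r; apply/(@cvgrPdist_le _ _ _ _ (nbhs_filter r)) => e e0; apply/nbhs_ballP.
  exists (e / (C + 1)) => /=; first by rewrite divr_gt0.
  move=> s; rewrite -ball_normE /= => rs; rewrite (le_trans (fL _ _)) //.
  apply: (@le_trans _ _ ((C + 1) * (e / (C + 1)))).
    by rewrite ler_pM ?lerDl // ltW.
  by rewrite mulrCA divff ?mulr1 // gt_eqF.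
pose S := [set r : 'rV[R]_k | `|r| = 1].
have cS : compact S.
  apply: bounded_closed_compact.
    by exists 1; split => // x x1 r; rewrite /S /= => ->; exact: ltW.
  rewrite (_ : S = (fun r : 'rV[R]_k => `|r|) @^-1` [set x : R | x = 1])//.
  apply: closed_comp; last exact: closed_eq.
  by move=> x _; exact: norm_continuous.
(* The sphere is empty when k = 0; then v = 0 is the only vector. *)
have [S0|S0] := pselect (S !=set0); last first.
  exists 1 => // v; have [->|v0] := eqVneq v 0.
    by rewrite normr0 mulr0; exact: is_norm_ge0.
  case: S0; exists (`|v|^-1 *: v^T).
  by rewrite /S /= normrZ mx_norm_tr normfV normr_id mulVf // normr_eq0.
have [r0 rS hr] := EVT_min_rV S0 cS (continuous_subspaceT fc).
have f0 : 0 < f r0.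
  rewrite lt_neqAle {2}/f (is_norm_ge0 _ hN) andbT eq_sym; apply/eqP => /sep r00.
  move: rS; rewrite inE /S /= -mx_norm_tr r00 normr0 => /esym/eqP.
  by rewrite oner_eq0.
exists (f r0) => // v; have [->|v0] := eqVneq v 0.
  by rewrite normr0 mulr0; exact: is_norm_ge0.
have nv : 0 < `|v| by rewrite normr_gt0.
have /hr : `|v|^-1 *: v^T \in S.
  by rewrite inE /S /= normrZ mx_norm_tr normfV normr_id mulVf // gt_eqF.
rewrite {2}/f linearZ /= trmxK hom normfV normr_id.
by rewrite ler_pdivlMl // mulrC.
Qed.

Lemma expmx_near n (M : 'M[R]_n.+1) p (e : R) : 0 < e ->
  exists2 d : R, 0 < d & forall M', `|M' - M| <= d -> `|M' ^+ p - M ^+ p| <= e.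
Proof.
elim: p e => [|p IH] e e0.
  by exists 1 => // M' _; rewrite !expr0 subrr normr0 ltW.
have [d d0 hd] := mx_norm_mul_near M (M ^+ p) e0.
have [d' d'0 hd'] := IH _ d0.
exists (Num.min d d'); first by rewrite lt_min d0.
move=> M'; rewrite le_min => /andP[h1 h2]; rewrite !exprS.
by apply: hd => //; exact: hd'.
Qed.
End MatrixNorm.

(** * The lattice of A and the change of norms *)

Section Lattice.
Variable R : realType.

(* The points (A q - p, q) with p and q integer. *)
Definition lat m n (A : 'M[R]_(m, n)) (x : 'cV[R]_m) (q : 'cV[R]_n) : Prop :=
  integer_vec R n q /\ integer_vec R m (A *m q - x).

Section Characterization.
Variables (m n : nat) (m0 : (0 < m)%N) (n0 : (0 < n)%N).
Variables (rho : 'cV[R]_m -> R) (sigma : 'cV[R]_n -> R).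
Hypotheses (Hrho : is_norm rho) (Hsigma : is_norm sigma).
Variable A : 'M[R]_(m, n).

(** This lemma and the next one trade the lower limit and the inner infimum for lattice points with
    q arbitrarily far out, the form used in all later estimates. *)
Lemma lagrange_constant_le (r : R) :
  (forall M : R, exists x q, [/\ lat A x q, M <= `|q| &
    sigma q ^+ n * rho x ^+ m <= r]) ->
  lagrange_constant rho sigma A <= r.
Proof.
move=> h; rewrite -lee_fin fineK ?lagrange_liminf_fin //.
rewrite /lagrange_liminf limf_einfE; apply/ge_ereal_sup => _ [V [M _ MV] <-].
have [x [q [[qZ pZ] Mq xq]]] := h M.
apply: (@le_trans _ _ (lagrange_fun rho sigma A q)%:E).
  by apply: ereal_inf_lbound; exists q => //; exact: MV.
rewrite lee_fin (le_trans _ xq) // /lagrange_fun ler_wpM2l //.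
  by rewrite exprn_ge0 // is_norm_ge0.
apply: ge_inf.
  by exists 0 => _ [p _ <-]; rewrite exprn_ge0 // is_norm_ge0.
by exists (A *m q - x) => //; rewrite subKr.
Qed.

Lemma lagrange_constant_lt (r M : R) : lagrange_constant rho sigma A < r ->
  exists x q, [/\ lat A x q, M <= `|q| & sigma q ^+ n * rho x ^+ m < r].
Proof.
move=> hr; apply: contrapT => h; move: hr; apply/negP; rewrite -leNgt.
have {}h x q : lat A x q -> M <= `|q| -> r <= sigma q ^+ n * rho x ^+ m.
  move=> xq Mq; rewrite leNgt; apply/negP => lt.
  by apply: h; exists x, q.
rewrite -lee_fin fineK ?lagrange_liminf_fin //.
rewrite /lagrange_liminf limf_einfE.
pose V := [set q | M <= `|q| /\ integer_vec R n q].
apply: (@le_trans _ _ (ereal_inf [set (lagrange_fun rho sigma A q)%:E | q in V])).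
  apply/le_ereal_inf_tmp => _ [q [Mq qZ] <-]; rewrite lee_fin /lagrange_fun.
  set S := [set _ | _ in _].
  have S0 : S !=set0.
    by exists (rho (A *m q - intv 0) ^+ m), (intv 0) => //; exists 0.
  have hS s : S s -> r <= sigma q ^+ n * s.
    move=> [p pZ <-]; apply: h => //; split => //.
    by rewrite subKr.
  have := exprn_ge0 n (is_norm_ge0 q Hsigma); rewrite le0r => /orP[/eqP s0|s0].
    by case: S0 => s /hS; rewrite s0 !mul0r.
  rewrite -ler_pdivrMl //; apply: lb_le_inf => // s /hS.
  by rewrite -ler_pdivrMl.
apply/ereal_sup_ubound; exists V => //.
by exists M => // q Mq qZ; split.
Qed.

Lemma lagrange_constant_ge0 : 0 <= lagrange_constant rho sigma A.
Proof.
have [C /(_ A)/andP[h0 _]] := lagrange_liminf_bound m0 n0 Hrho Hsigma.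
by rewrite -lee_fin fineK ?lagrange_liminf_fin.
Qed.

End Characterization.

Lemma is_norm_comp k l (N : 'cV[R]_k -> R) (B : 'M[R]_(k, l)) (B' : 'M[R]_(l, k)) :
  B' *m B = 1%:M -> is_norm N -> is_norm (N \o mulmx B).
Proof.
move=> BB' [tri hom sep]; split => [x y|a x|x] /=.
- by rewrite mulmxDr.
- by rewrite -scalemxAr hom.
- by move/sep => /(congr1 (mulmx B')); rewrite mulmxA BB' mul1mx mulmx0.
Qed.

Lemma is_norm_unit k (N : 'cV[R]_k -> R) (B : 'M[R]_k) :
  B \in unitmx -> is_norm N -> is_norm (N \o mulmx B).
Proof. by move=> uB; apply: (@is_norm_comp _ _ _ _ (invmx B)); rewrite mulVmx. Qed.

Lemma is_normN k (N : 'cV[R]_k -> R) v : is_norm N -> N (- v) = N v.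
Proof. by move=> [_ hom _]; rewrite -scaleN1r hom normrN1 mul1r. Qed.

Lemma is_norm_le k (N : 'cV[R]_k -> R) : is_norm N ->
  exists2 C : R, 0 <= C & forall v, N v <= C * `|v|.
Proof.
move=> /is_norm_bound[C C0 hC]; exists C => // v.
by apply: hC => i; exact: mx_entry_le.
Qed.

(** By convexity (1 + d)^k stays below its chord 1 + d (2^k - 1) on [0, 1]. *)
Lemma expr1D_le k (e : R) : 0 < e ->
  exists2 d : R, 0 < d & d <= 2^-1 /\ (1 + d) ^+ k <= 1 + e.
Proof.
move=> e0; have p0 : 0 < 2 ^+ k :> R by rewrite exprn_gt0.
pose d : R := Num.min 2^-1 (e / 2 ^+ k).
have d0 : 0 < d by rewrite lt_min invr_gt0 ltr0n divr_gt0.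
have d2 : d <= 2^-1 by rewrite ge_min lexx.
exists d => //; split => //.
have H : (1 + d) ^+ k <= 1 + d * (2 ^+ k - 1).
  move: (d) d0 d2; clear; move=> d d0 d2.
  elim: k => [|k IH]; first by rewrite !expr0; lra.
  have c1 : 1 <= 2 ^+ k :> R by rewrite exprn_ege1 // ler1n.
  rewrite !exprS; apply: (@le_trans _ _ ((1 + d) * (1 + d * (2 ^+ k - 1)))).
    by rewrite ler_wpM2l //; lra.
  rewrite -subr_ge0; move: (2 ^+ k) c1 => c c1.
  have -> : 1 + d * (2 * c - 1) - (1 + d) * (1 + d * (c - 1)) =
    d * ((c - 1) * (1 - d)) by ring.
  by rewrite !mulr_ge0 //; lra.
apply: le_trans H _; rewrite lerD2l.
apply: (@le_trans _ _ (d * 2 ^+ k)); first by rewrite ler_wpM2l ?ltW //; lra.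
by rewrite -ler_pdivlMr // ge_min lexx orbT.
Qed.

(* g is irrelevant in the limit q --> oo. *)
Definition reach m n (A A' : 'M[R]_(m, n)) (b : 'M[R]_m) (c : 'M[R]_n)
    (g : 'M[R]_(n, m)) : Prop :=
  [/\ b \in unitmx, c \in unitmx, `|\det b * \det c| = 1 &
    forall x q, lat A x q <-> lat A' (b *m x) (c *m q - g *m x)].

(** The map (x, q) |-> (b x, c q - g x) is block triangular; here its inverse is read off, and its
    composition with another such map in the next lemma. *)
Lemma reach_sym m n (A A' : 'M[R]_(m, n)) b c g : reach A A' b c g ->
  reach A' A (invmx b) (invmx c) (- (invmx c *m g *m invmx b)).
Proof.
move=> [ub uc dt h]; split; rewrite ?unitmx_inv //.
  by rewrite !det_inv -invfM normfV dt invr1.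
move=> x q; rewrite (h (invmx b *m x)) mulKVmx // mulNmx opprK.
rewrite mulmxDr mulKVmx // -!mulmxA mulKVmx //.
by rewrite addrK.
Qed.

Lemma reach_trans m n (A A' A'' : 'M[R]_(m, n)) b c g b' c' g' :
  reach A A' b c g -> reach A' A'' b' c' g' ->
  reach A A'' (b' *m b) (c' *m c) (c' *m g + g' *m b).
Proof.
move=> [ub uc dt h] [ub' uc' dt' h']; split.
- by rewrite unitmx_mul ub'.
- by rewrite unitmx_mul uc'.
- by rewrite !det_mulmx mulrACA normrM dt dt' mul1r.
by move=> x q; rewrite h h' mulmxBr !mulmxA mulmxDl opprD addrA.
Qed.

Section Transfer.
Variables (m n : nat) (m0 : (0 < m)%N) (n0 : (0 < n)%N).

(* Along good approximations x stays bounded, so that c q - g x equals c q up to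
   a relative error o(1). *)
Lemma reach_lagrange_le (rho : 'cV[R]_m -> R) (sigma : 'cV[R]_n -> R)
  (Hrho : is_norm rho) (Hsigma : is_norm sigma) (A A' : 'M[R]_(m, n)) b c g : reach A A' b c g ->
  lagrange_constant rho sigma A' <=
  lagrange_constant (rho \o mulmx b) (sigma \o mulmx c) A.
Proof.
move=> [ub uc _ h].
have Hb := is_norm_unit ub Hrho; have Hc := is_norm_unit uc Hsigma.
set l := lagrange_constant _ _ A.
have l0 : 0 <= l by exact: lagrange_constant_ge0.
have [cb cb0 hb] := is_norm_ge Hb; have [cc cc0 hc] := is_norm_ge Hc.
have [Cs Cs0 hs] := is_norm_le Hsigma; have [tri _ _] := Hsigma.
apply/ler_addgt0Pr => e e0; pose r := l + e / 2.
have lr : l < r by rewrite ltrDl divr_gt0.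
have r0 : 0 < r := le_lt_trans l0 lr.
(* With this choice (1 + d)^n r is at most r + e / 2 = l + e. *)
have [d d0 [d2 hd]] := @expr1D_le n (e / (2 * r)) (divr_gt0 e0 (mulr_gt0 (ltr0n _ 2) r0)).
have d1 : 0 <= 1 + d by rewrite addr_ge0 // ltW.
pose K := Cs * (m%:R * `|g|) / cb.
have K0 : 0 <= K by rewrite divr_ge0 ?mulr_ge0 // ltW.
apply: lagrange_constant_le => // M.
(* Put z = sigma (c q) and y = rho (b x). The summand 1 + r forces y <= 1, since z^n y^m < r; K / d
   then gives sigma (g x) <= K <= d z; the last summand keeps the new vector c q - g x beyond M. *)
have [x [q [xq qM xqr]]] := lagrange_constant_lt m0 n0 Hb Hc
  ((1 + r + K / d + 2 * (Cs + 1) * `|M|) / cc) lr.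
exists (b *m x), (c *m q - g *m x); move: qM xqr.
rewrite ler_pdivrMr // [_ * cc]mulrC => /le_trans/(_ (hc q)).
set z := (_ \o _) q; set y := (_ \o _) x => zM zyr.
have y0 : 0 <= y by exact: (is_norm_ge0 x Hb).
have Kd : 0 <= K / d by rewrite divr_ge0 // ltW.
have M0 : 0 <= 2 * (Cs + 1) * `|M| by rewrite !mulr_ge0 // addr_ge0.
have z1 : 1 <= z by lra.
have y1 : y <= 1.
  rewrite leNgt; apply/negP => y1.
  have : z <= z ^+ n * y ^+ m.
    apply: (@le_trans _ _ (z ^+ n)); first by rewrite ler_eXnr.
    by rewrite ler_peMr ?exprn_ege1 // ?exprn_ge0 ?ltW //; lra.
  lra.
have gx : sigma (g *m x) <= d * z.
  apply: (@le_trans _ _ K).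
    rewrite (le_trans (hs _)) // /K -mulrA ler_wpM2l //.
    rewrite (le_trans (mx_norm_mul _ _)) // ler_wpM2l ?mulr_ge0 //.
    by rewrite -[cb^-1]mul1r ler_pdivlMr // mulrC (le_trans (hb _)).
  by rewrite mulrC -ler_pdivrMr //; lra.
have zE : sigma (c *m q) = z by [].
split; first by rewrite -h.
- have : z <= Cs * `|c *m q - g *m x| + d * z.
    rewrite -zE -{1}(subrK (g *m x) (c *m q)) (le_trans (tri _ _)) //.
    by rewrite zE lerD.
  have dz : d * z <= 2^-1 * z by rewrite ler_wpM2r //; lra.
  move=> hz; apply: le_trans (ler_norm M) _.
  have Cs1 : 0 < Cs + 1 by rewrite ltr_wpDl.
  rewrite -(ler_pM2l Cs1).
  have := normr_ge0 (c *m q - g *m x); lra.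
- apply: (@le_trans _ _ (((1 + d) * z) ^+ n * y ^+ m)).
    have v0 := is_norm_ge0 (c *m q - g *m x) Hsigma.
    have w0 : 0 <= (1 + d) * z by rewrite mulr_ge0 // (le_trans ler01 z1).
    rewrite ler_wpM2r ?exprn_ge0 // lerXn2r ?nnegrE //.
    have := tri (c *m q) (- (g *m x)).
    by rewrite (is_normN _ Hsigma) zE; lra.
  rewrite exprMn -mulrA (@le_trans _ _ ((1 + d) ^+ n * r)) //.
    by rewrite ler_wpM2l ?(ltW zyr) // exprn_ge0.
  apply: (@le_trans _ _ ((1 + e / (2 * r)) * r)); first by rewrite ler_wpM2r // ltW.
  have -> : (1 + e / (2 * r)) * r = r + e / 2.
    by field; rewrite gt_eqF.
  by rewrite /r -addrA -splitr.
Qed.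

(** The reverse inequality is the previous one for the inverse move [reach_sym], applied to the
    norms rho o b and sigma o c. *)
Lemma reach_lagrange (rho : 'cV[R]_m -> R) (sigma : 'cV[R]_n -> R)
  (Hrho : is_norm rho) (Hsigma : is_norm sigma) (A A' : 'M[R]_(m, n)) b c g : reach A A' b c g ->
  lagrange_constant rho sigma A' =
  lagrange_constant (rho \o mulmx b) (sigma \o mulmx c) A.
Proof.
move=> rc; have [ub uc _ _] := rc.
apply/eqP; rewrite eq_le (reach_lagrange_le Hrho Hsigma rc) /=.
have hr : rho = (rho \o mulmx b) \o mulmx (invmx b).
  by apply/funext => x /=; rewrite mulKVmx.
have hs : sigma = (sigma \o mulmx c) \o mulmx (invmx c).
  by apply/funext => x /=; rewrite mulKVmx.
rewrite [in leRHS]hr [in leRHS]hs.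
have H1 := is_norm_unit ub Hrho; have H2 := is_norm_unit uc Hsigma.
have H3 := reach_sym rc.
exact: (reach_lagrange_le H1 H2 H3).
Qed.
End Transfer.
End Lattice.

(** * Continuity in the norms *)

Section Ratio.
Variable R : realType.

(** The second bound rests on (1 + 2 th) (1 - th) >= 1, valid for 0 <= th <= 1/2. *)
Lemma sandwich (th x y : R) : 0 <= x -> 0 <= y -> 0 <= th -> th <= 2^-1 ->
  y <= x + th * x -> x <= y + th * x -> y <= (1 + 2 * th) * x /\ x <= (1 + 2 * th) * y.
Proof.
move=> x0 y0 th0 th2 yx xy; split; first by nra.
have h1 : (1 - th) * x <= y by lra.
apply: (@le_trans _ _ ((1 + 2 * th) * ((1 - th) * x))); last by rewrite ler_wpM2l //; lra.
have -> : (1 + 2 * th) * ((1 - th) * x) = x + 2 * (th * ((2^-1 - th) * x)) by field.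
by rewrite lerDl !mulr_ge0 //; lra.
Qed.

Section Constant.
Variables (m n : nat) (m0 : (0 < m)%N) (n0 : (0 < n)%N).
Variable A : 'M[R]_(m, n).

Lemma lagrange_constant_mono (rho rho' : 'cV[R]_m -> R)
    (sigma sigma' : 'cV[R]_n -> R) (k j : R) :
  is_norm rho -> is_norm rho' -> is_norm sigma -> is_norm sigma' ->
  0 <= k -> 0 <= j ->
  (forall x, rho' x <= k * rho x) -> (forall q, sigma' q <= j * sigma q) ->
  lagrange_constant rho' sigma' A <= j ^+ n * k ^+ m * lagrange_constant rho sigma A.
Proof.
move=> Hr Hr' Hs Hs' k0 j0 hk hj; set l := lagrange_constant rho sigma A.
apply/ler_addgt0Pr => e e0; set K := j ^+ n * k ^+ m.
have K0 : 0 <= K by rewrite mulr_ge0 ?exprn_ge0.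
have K1 : 0 < K + 1 by rewrite ltr_wpDl.
apply: lagrange_constant_le => // M.
have le : l < l + e / (K + 1) by rewrite ltrDl divr_gt0.
have [x [q [xq qM h]]] := lagrange_constant_lt m0 n0 Hr Hs M le.
exists x, q; split => //.
apply: (@le_trans _ _ (K * (sigma q ^+ n * rho x ^+ m))).
  rewrite /K mulrACA -!exprMn ler_pM ?exprn_ge0 ?is_norm_ge0 //.
  - rewrite lerXn2r ?nnegrE ?hj ?(is_norm_ge0 _ Hs') //.
    by rewrite mulr_ge0 // (is_norm_ge0 _ Hs).
  - rewrite lerXn2r ?nnegrE ?hk ?(is_norm_ge0 _ Hr') //.
    by rewrite mulr_ge0 // (is_norm_ge0 _ Hr).
apply: (@le_trans _ _ (K * (l + e / (K + 1)))); first by rewrite ler_wpM2l // ltW.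
rewrite mulrDr lerD2l mulrCA ger_pMr // ler_pdivrMr // mul1r lerDl //.
Qed.

Section Fixed.
Variables (rho : 'cV[R]_m -> R) (sigma : 'cV[R]_n -> R).
Hypotheses (Hrho : is_norm rho) (Hsigma : is_norm sigma).

(** The numerator is homogeneous of degree m in B and n in C, like the determinants. The quotient
    can thus be evaluated at matrices b and c known up to scalars only. *)
Definition lagrange_ratio (B : 'M[R]_m) (C : 'M[R]_n) : R :=
  lagrange_constant (rho \o mulmx B) (sigma \o mulmx C) A / `|\det B * \det C|.

Lemma lagrange_ratio1 : lagrange_ratio 1%:M 1%:M = lagrange_constant rho sigma A.
Proof.
rewrite /lagrange_ratio !det1 mulr1 normr1 divr1.
have -> : rho \o mulmx 1%:M = rho by apply/funext => x /=; rewrite mul1mx.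
by have -> : sigma \o mulmx 1%:M = sigma by apply/funext => x /=; rewrite mul1mx.
Qed.

Lemma lagrange_ratio_ge0 B C : B \in unitmx -> C \in unitmx -> 0 <= lagrange_ratio B C.
Proof.
move=> uB uC; rewrite divr_ge0 //; apply: lagrange_constant_ge0 => //.
- exact: is_norm_unit.
- exact: is_norm_unit.
Qed.

Lemma lagrange_ratio_scale B C (s t : R) : B \in unitmx -> C \in unitmx ->
  s != 0 -> t != 0 -> lagrange_ratio (s *: B) (t *: C) = lagrange_ratio B C.
Proof.
have half B1 C1 (s1 t1 : R) : B1 \in unitmx -> C1 \in unitmx ->
    s1 != 0 -> t1 != 0 -> lagrange_ratio (s1 *: B1) (t1 *: C1) <= lagrange_ratio B1 C1.
  clear B C s t; move: B1 C1 s1 t1 => B C s t.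
  move=> uB uC s0 t0; rewrite /lagrange_ratio !detZ.
  have hB := is_norm_unit uB Hrho; have hC := is_norm_unit uC Hsigma.
  have uB' : s *: B \in unitmx by rewrite unitmxZ // unitfE.
  have uC' : t *: C \in unitmx by rewrite unitmxZ // unitfE.
  have hB' := is_norm_unit uB' Hrho; have hC' := is_norm_unit uC' Hsigma.
  have D0 : 0 < `|\det B * \det C|.
    by rewrite normr_gt0 mulf_neq0 // -unitfE -unitmxE.
  have S0 : 0 < `|t| ^+ n * `|s| ^+ m by rewrite mulr_gt0 ?exprn_gt0 ?normr_gt0.
  have -> : `|s ^+ m * \det B * (t ^+ n * \det C)| =
      `|t| ^+ n * `|s| ^+ m * `|\det B * \det C|.
    by rewrite !normrM !normrX; ring.
  rewrite invfM mulrA ler_wpM2r ?invr_ge0 ?(ltW D0) // ler_pdivrMr // mulrC.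
  apply: lagrange_constant_mono => //.
  - move=> x /=; case: Hrho => _ h _.
    by rewrite -scalemxAl h.
  - move=> x /=; case: Hsigma => _ h _.
    by rewrite -scalemxAl h.
move=> uB uC s0 t0; apply/eqP; rewrite eq_le half //=.
have := half (s *: B) (t *: C) s^-1 t^-1.
rewrite !scalerA !mulVf // !scale1r; apply; rewrite ?invr_eq0 //.
- by rewrite unitmxZ // unitfE.
- by rewrite unitmxZ // unitfE.
Qed.

Lemma reach_lagrange_ratio A' b c g : reach A A' b c g ->
  lagrange_constant rho sigma A' = lagrange_ratio b c.
Proof.
move=> rc; rewrite (reach_lagrange m0 n0 Hrho Hsigma rc) /lagrange_ratio.
by have [_ _ -> _] := rc; rewrite divr1.
Qed.

(** As N (B x) >= c |x| with c > 0, an absolute error on B is a relative error on N (B x), uniformly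
    in x. *)
Lemma norm_comp_near k (N : 'cV[R]_k -> R) (B : 'M[R]_k) (e : R) :
  is_norm N -> B \in unitmx -> 0 < e ->
  exists2 d : R, 0 < d & forall B', `|B' - B| <= d -> forall x,
    N (B' *m x) <= (1 + e) * N (B *m x) /\ N (B *m x) <= (1 + e) * N (B' *m x).
Proof.
move=> HN uB e0; have hB := is_norm_unit uB HN.
have [c c0 hc] := is_norm_ge hB; have [C C0 hC] := is_norm_le HN.
have [tri _ _] := HN.
pose th := Num.min 2^-1 (e / 2).
have th0 : 0 < th by rewrite lt_min invr_gt0 ltr0n divr_gt0.
pose K : R := (C + 1) * (k%:R + 1).
have K0 : 0 < K by rewrite mulr_gt0 ?ltr_wpDl.
exists (th * c / K); first by rewrite divr_gt0 // mulr_gt0.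
move=> B' hB' x.
have hE : N ((B' - B) *m x) <= th * N (B *m x).
  apply: (@le_trans _ _ (K * (th * c / K * `|x|))).
    rewrite (le_trans (hC _)) // /K -mulrA ler_pM ?lerDl //.
    rewrite (le_trans (mx_norm_mul _ _)) // -mulrA ler_pM ?lerDl ?mulr_ge0 //.
    by rewrite ler_wpM2r.
  have -> : K * (th * c / K * `|x|) = th * (c * `|x|) by field; rewrite gt_eqF.
  by rewrite ler_wpM2l ?(ltW th0) //; exact: hc.
have [|||||h1 h2] := @sandwich th (N (B *m x)) (N (B' *m x)) _ _ (ltW th0).
- exact: is_norm_ge0.
- exact: is_norm_ge0.
- by rewrite ge_min lexx.
- by rewrite -{1}(subrK B B') mulmxDl addrC (le_trans (tri _ _)) // lerD2l.
- rewrite -{1}(subKr B' B) mulmxBl (le_trans (tri _ _)) // (is_normN _ HN).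
  by rewrite lerD2l.
have the : 1 + 2 * th <= 1 + e.
  by rewrite lerD2l mulrC -ler_pdivlMr // ge_min lexx orbT.
by split; [apply: le_trans h1 _|apply: le_trans h2 _]; rewrite ler_wpM2r // is_norm_ge0.
Qed.

Lemma det_near_ratio k (B : 'M[R]_k) (e : R) : B \in unitmx -> 0 < e ->
  exists2 d : R, 0 < d & forall B', `|B' - B| <= d ->
    `|\det B'| <= (1 + e) * `|\det B| /\ `|\det B| <= (1 + e) * `|\det B'|.
Proof.
move=> uB e0; have D0 : 0 < `|\det B| by rewrite normr_gt0 -unitfE -unitmxE.
pose th := Num.min 2^-1 (e / 2).
have th0 : 0 < th by rewrite lt_min invr_gt0 ltr0n divr_gt0.
have [d d0 hd] := det_near B (mulr_gt0 th0 D0).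
exists d => // B' /hd hE.
have [|||||h1 h2] := @sandwich th `|\det B| `|\det B'| _ _ (ltW th0).
- by [].
- by [].
- by rewrite ge_min lexx.
- by rewrite -{1}(subrK (\det B) (\det B')) addrC (le_trans (ler_normD _ _)) // lerD2l.
- by rewrite -{1}(subKr (\det B') (\det B)) (le_trans (ler_normB _ _)) // lerD2l.
have the : 1 + 2 * th <= 1 + e.
  by rewrite lerD2l mulrC -ler_pdivlMr // ge_min lexx orbT.
by split; [apply: le_trans h1 _|apply: le_trans h2 _]; rewrite ler_wpM2r.
Qed.

Lemma lagrange_ratio_near B C (e : R) : B \in unitmx -> C \in unitmx -> 0 < e ->
  exists2 d : R, 0 < d & forall B' C', `|B' - B| <= d -> `|C' - C| <= d ->
    [/\ B' \in unitmx, C' \in unitmx &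
        `|lagrange_ratio B' C' - lagrange_ratio B C| <= e].
Proof.
move=> uB uC e0; set v := lagrange_ratio B C.
have v0 : 0 <= v := lagrange_ratio_ge0 uB uC.
(* Comparing both ways up to the factor 1 + f gives a difference of at most f (1 + f) v <= 2 f v. *)
pose f : R := Num.min 1 (e / (2 * v + 1)).
have v1 : 0 < 2 * v + 1 by lra.
have f0 : 0 < f by rewrite lt_min ltr01 divr_gt0.
(* Each comparison loses a factor 1 + h: n times for sigma, m times for rho, and once for each of
   the two determinants. *)
have [h h0 [h2 hf]] := expr1D_le (n + m + 2) f0.
have [d1 d10 hd1] := norm_comp_near Hrho uB h0.
have [d2 d20 hd2] := norm_comp_near Hsigma uC h0.
have [d3 d30 hd3] := det_near_ratio uB h0.
have [d4 d40 hd4] := det_near_ratio uC h0.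
have [d5 d50 hd5] := invmx_near uB e0.
have [d6 d60 hd6] := invmx_near uC e0.
exists (Num.min (Num.min d1 (Num.min d3 d5)) (Num.min d2 (Num.min d4 d6))).
  by rewrite !lt_min d10 d20 d30 d40 d50 d60.
move=> B' C'; rewrite !le_min => /andP[/and3P[b1 b3 b5] _] /andP[_ /and3P[c2 c4 c6]].
have [uB' _] := hd5 _ b5; have [uC' _] := hd6 _ c6.
split => //.
have key B1 C1 B2 C2 : B1 \in unitmx -> C1 \in unitmx -> B2 \in unitmx -> C2 \in unitmx ->
    (forall x, rho (B1 *m x) <= (1 + h) * rho (B2 *m x)) ->
    (forall x, sigma (C1 *m x) <= (1 + h) * sigma (C2 *m x)) ->
    `|\det B2| <= (1 + h) * `|\det B1| -> `|\det C2| <= (1 + h) * `|\det C1| ->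
    lagrange_ratio B1 C1 <= (1 + f) * lagrange_ratio B2 C2.
  move=> uB1 uC1 uB2 uC2 hr hs hB hC.
  have h1 : 0 <= 1 + h by lra.
  have D1 : 0 < `|\det B1 * \det C1|.
    by rewrite normr_gt0 mulf_neq0 // -unitfE -unitmxE.
  have D2 : 0 < `|\det B2 * \det C2|.
    by rewrite normr_gt0 mulf_neq0 // -unitfE -unitmxE.
  rewrite /lagrange_ratio ler_pdivrMr //.
  have l0 : 0 <= lagrange_constant (rho \o mulmx B2) (sigma \o mulmx C2) A.
    apply: lagrange_constant_ge0 => //; exact: is_norm_unit.
  have D12 : `|\det B2 * \det C2| <= (1 + h) ^+ 2 * `|\det B1 * \det C1|.
    rewrite !normrM expr2 mulrACA ler_pM //.
  apply: le_trans (lagrange_constant_mono (is_norm_unit uB2 Hrho)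
    (is_norm_unit uB1 Hrho) (is_norm_unit uC2 Hsigma) (is_norm_unit uC1 Hsigma)
    h1 h1 hr hs) _.
  move: l0; set l := lagrange_constant _ _ _ => l0.
  set q := `|\det B1 * \det C1| / `|\det B2 * \det C2|.
  have q0 : 0 <= q by rewrite divr_ge0.
  have E : 1 <= (1 + h) ^+ 2 * q by rewrite /q mulrA ler_pdivlMr // mul1r.
  have -> : (1 + f) * (l / `|\det B2 * \det C2|) * `|\det B1 * \det C1| =
    (1 + f) * (l * q) by rewrite /q; ring.
  apply: (@le_trans _ _ ((1 + h) ^+ n * (1 + h) ^+ m * l * ((1 + h) ^+ 2 * q))).
    by rewrite ler_peMr // !mulr_ge0 // exprn_ge0.
  have -> : (1 + h) ^+ n * (1 + h) ^+ m * l * ((1 + h) ^+ 2 * q) =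
    (1 + h) ^+ (n + m + 2) * (l * q) by rewrite !exprD; ring.
  by rewrite ler_wpM2r // mulr_ge0.
have k1 := key B' C' B C uB' uC' uB uC (fun x => (hd1 _ b1 x).1)
  (fun x => (hd2 _ c2 x).1) (hd3 _ b3).2 (hd4 _ c4).2.
have k2 := key B C B' C' uB uC uB' uC' (fun x => (hd1 _ b1 x).2)
  (fun x => (hd2 _ c2 x).2) (hd3 _ b3).1 (hd4 _ c4).1.
move: k1 k2; rewrite -/v; have := lagrange_ratio_ge0 uB' uC'.
move: (lagrange_ratio B' C') => v' v'0 k1 k2.
have f1 : f <= 1 by rewrite ge_min lexx.
have fe : f * (2 * v + 1) <= e by rewrite -ler_pdivlMr // ge_min lexx orbT.
have fv' : f * v' <= f * ((1 + f) * v) by rewrite ler_wpM2l // ltW.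
have ffv : f * (f * v) <= f * v by rewrite ler_piMl // mulr_ge0 // ltW.
by rewrite ler_norml; apply/andP; split; lra.
Qed.

End Fixed.
End Constant.
End Ratio.

(** * Moebius maps *)

Section Reach.
Variable R : realType.

Lemma integer_vec_col m n (p : 'cV[R]_m) (q : 'cV[R]_n) :
  integer_vec R (m + n) (col_mx p q) <-> integer_vec R m p /\ integer_vec R n q.
Proof.
split => [[v _ vE]|[[u _ <-] [w _ <-]]]; last first.
  by exists (col_mx u w) => //; rewrite map_col_mx.
move: vE; rewrite -[v]vsubmxK map_col_mx => /eq_col_mx[<- <-].
by split; [exists (usubmx v)|exists (dsubmx v)].
Qed.

Lemma integer_vec_mul k l (W : 'M[int]_(k, l)) (v : 'cV[R]_l) :
  integer_vec R l v -> integer_vec R k (intv W *m v).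
Proof. by move=> [u _ <-]; exists (W *m u) => //; rewrite map_mxM. Qed.

Lemma intv_mulV k (W : 'M[int]_k) : W \in unitmx ->
  (intv W : 'M[R]_k) *m intv (invmx W) = 1%:M.
Proof. by move=> uW; rewrite -map_mxM mulmxV // map_mx1. Qed.

Lemma intv_Vmul k (W : 'M[int]_k) : W \in unitmx ->
  (intv (invmx W) : 'M[R]_k) *m intv W = 1%:M.
Proof. by move=> uW; rewrite -map_mxM mulVmx // map_mx1. Qed.

Lemma det_intv k (W : 'M[int]_k) : W \in unitmx ->
  `|\det (intv W : 'M[R]_k)| = 1.
Proof.
move=> uW; rewrite det_map_mx /= -intr_norm.
have := congr1 absz (congr1 determinant (mulmxV uW)).
rewrite det_mulmx det1 abszM => /eqP; rewrite muln_eq1 => /andP[/eqP h _].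
by rewrite -abszE h.
Qed.

Lemma intv_unitmx k (W : 'M[int]_k) : W \in unitmx -> (intv W : 'M[R]_k) \in unitmx.
Proof.
move=> /det_intv h; rewrite unitmxE unitfE -normr_eq0 h; exact: oner_neq0.
Qed.

(** Everything follows from W [1 A; 0 1] = [1 A'; 0 1] [b 0; ga c]. Determinants give |det b det c|
    = 1, hence the invertibility of b, and W permutes the integer vectors. *)
Lemma reach_moebius m n (W : 'M[int]_(m + n)) al be ga de (A : 'M[R]_(m, n)) :
  W \in unitmx -> intv W = block_mx al be ga de -> ga *m A + de \in unitmx ->
  let A' := (al *m A + be) *m invmx (ga *m A + de) in
  reach A A' (al - A' *m ga) (ga *m A + de) ga.
Proof.
move=> uW WE uc A'; set c := ga *m A + de; set b := al - A' *m ga.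
have A'c : A' *m c = al *m A + be by rewrite /A' mulmxKV.
have fact : intv W *m block_mx 1%:M A 0 1%:M =
    block_mx 1%:M A' 0 1%:M *m block_mx b 0 ga c.
  rewrite WE !mulmx_block !mulmx1 !mul1mx !mulmx0 !mul0mx !addr0 !add0r.
  by rewrite A'c subrK.
have detbc : `|\det b * \det c| = 1.
  move: (congr1 (fun M => `|\det M|) fact).
  rewrite !det_mulmx !det_ublock !det_lblock !det1 !mul1r mulr1 => <-.
  exact: det_intv.
have : \det b * \det c != 0 by rewrite -normr_eq0 detbc oner_neq0.
rewrite mulf_eq0 negb_or -!unitfE -!unitmxE => /andP[ub _].
split => // x q.
have WpE : intv W *m col_mx (A *m q - x) q =
    col_mx (A' *m (c *m q - ga *m x) - b *m x) (c *m q - ga *m x).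
  rewrite WE mul_block_col; congr col_mx.
    rewrite [in RHS]mulmxBr [in RHS]mulmxA A'c /b !mulmxBl !mulmxDl mulmxBr !mulmxA.
    by rewrite opprB addrA subrK addrAC.
  by rewrite mulmxBr mulmxDl mulmxA addrAC.
split=> [[qZ pZ]|[qZ pZ]].
  have /(integer_vec_mul W) : integer_vec R (m + n) (col_mx (A *m q - x) q).
    exact/integer_vec_col.
  by rewrite WpE => /integer_vec_col[].
have : integer_vec R (m + n) (intv W *m col_mx (A *m q - x) q).
  by rewrite WpE; exact/integer_vec_col.
move=> /(integer_vec_mul (invmx W)); rewrite mulmxA intv_Vmul // mul1mx.
by move=> /integer_vec_col[].
Qed.

Lemma reach_diag m n (P : 'M[int]_m) (Q : 'M[int]_n) (A : 'M[R]_(m, n)) :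
  P \in unitmx -> Q \in unitmx ->
  reach A (intv P *m A *m invmx (intv Q)) (intv P) (intv Q) 0.
Proof.
move=> uP uQ.
have uW : block_mx P 0 0 Q \in unitmx.
  by rewrite unitmxE det_ublock unitrM -!unitmxE uP.
have WE : intv (block_mx P 0 0 Q) = block_mx (intv P) 0 0 (intv Q) :> 'M[R]_(m + n).
  by rewrite map_block_mx !map_mx0.
have := @reach_moebius _ _ _ _ _ _ _ A uW WE.
rewrite mul0mx add0r addr0 => /(_ (intv_unitmx uQ)) /=.
by rewrite mulmx0 subr0.
Qed.

(* b and c can be brought close to B and C up to scalars, while A' is close to 0;
   the latter allows steps to be composed. *)
Definition steerable m n (B : 'M[R]_m) (C : 'M[R]_n) : Prop :=
  forall (A : 'M[R]_(m, n)) (e : R), 0 < e ->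
  exists A' b c g (s t : R), [/\ reach A A' b c g, s != 0 & t != 0] /\
    [/\ `|A'| <= e, `|s *: b - B| <= e & `|t *: c - C| <= e].

(** The second move starts from the end point A1 of the first, wherever that is; hence the
    quantification over all A in [steerable]. *)
Lemma steerable_mul m n (B1 B2 : 'M[R]_m) (C1 C2 : 'M[R]_n) :
  steerable B1 C1 -> steerable B2 C2 -> steerable (B2 *m B1) (C2 *m C1).
Proof.
move=> h1 h2 A e e0.
have [d d0 hd] := mx_norm_mul_near B2 B1 e0.
have [d' d'0 hd'] := mx_norm_mul_near C2 C1 e0.
have f0 : 0 < Num.min d d' by rewrite lt_min d0.
have ef0 : 0 < Num.min e (Num.min d d') by rewrite lt_min e0.
have [A1 [b1 [c1 [g1 [s1 [t1 [[r1 s10 t10] [_ hb1 hc1]]]]]]]] := h1 A _ f0.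
have [A2 [b2 [c2 [g2 [s2 [t2 [[r2 s20 t20] [hA hb2 hc2]]]]]]]] := h2 A1 _ ef0.
move: hA hb1 hc1 hb2 hc2; rewrite !le_min.
move=> /andP[Ae _] /andP[b1d _] /andP[_ c1d] /and3P[_ b2d _] /and3P[_ _ c2d].
exists A2, (b2 *m b1), (c2 *m c1), (c2 *m g1 + g2 *m b1), (s2 * s1), (t2 * t1).
split; split => //.
- exact: reach_trans r1 r2.
- exact: mulf_neq0.
- exact: mulf_neq0.
- by rewrite -scalerA scalemxAr scalemxAl; exact: hd.
- by rewrite -scalerA scalemxAr scalemxAl; exact: hd'.
Qed.

Lemma steerable_lim m n (B : 'M[R]_m) (C : 'M[R]_n) :
  (forall e : R, 0 < e -> exists B' C',
     [/\ steerable B' C', `|B' - B| <= e & `|C' - C| <= e]) -> steerable B C.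
Proof.
move=> h A e e0; have e20 : 0 < e / 2 by rewrite divr_gt0.
have [B' [C' [st hB hC]]] := h _ e20.
have [A1 [b [c [g [s [t [r [hA hb hc]]]]]]]] := st A _ e20.
exists A1, b, c, g, s, t; split => //; split.
- by rewrite (le_trans hA) // ler_pdivrMr // mulr2n mulrDr mulr1 lerDl ltW.
- rewrite -(subrKA B') (le_trans (ler_normD _ _)) //.
  by rewrite [leRHS]splitr lerD.
- rewrite -(subrKA C') (le_trans (ler_normD _ _)) //.
  by rewrite [leRHS]splitr lerD.
Qed.

Lemma steerable_scale m n (B : 'M[R]_m) (C : 'M[R]_n) (s t : R) :
  s != 0 -> t != 0 -> steerable B C -> steerable (s *: B) (t *: C).
Proof.
move=> s0 t0 h A e e0.
pose f := Num.min e (Num.min (e / `|s|) (e / `|t|)).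
have ns : 0 < `|s| by rewrite normr_gt0.
have nt : 0 < `|t| by rewrite normr_gt0.
have f0 : 0 < f by rewrite !lt_min e0 !divr_gt0.
have [A1 [b [c [g [s1 [t1 [[r s10 t10] [hA hb hc]]]]]]]] := h A _ f0.
move: hA hb hc; rewrite !le_min.
move=> /andP[Ae _] /and3P[_ bd _] /and3P[_ _ cd].
exists A1, b, c, g, (s * s1), (t * t1); split; split => //; rewrite ?mulf_neq0 //.
- by rewrite -scalerA -scalerBr normrZ mulrC -ler_pdivlMr.
- by rewrite -scalerA -scalerBr normrZ mulrC -ler_pdivlMr.
Qed.

(** The integer change of coordinates is made before the move, which then starts from P A Q^-1. *)
Lemma steerable_intr m n (B : 'M[R]_m) (C : 'M[R]_n) (P : 'M[int]_m) (Q : 'M[int]_n) :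
  P \in unitmx -> Q \in unitmx -> steerable B C ->
  steerable (B *m intv P) (C *m intv Q).
Proof.
move=> uP uQ h A e e0.
have [d d0 hd] := mx_norm_mul_near B (intv P) e0.
have [d' d'0 hd'] := mx_norm_mul_near C (intv Q) e0.
have f0 : 0 < Num.min e (Num.min d d') by rewrite !lt_min e0 d0.
have [A1 [b [c [g [s [t [[r s0 t0] [hA hb hc]]]]]]]] :=
  h (intv P *m A *m invmx (intv Q)) _ f0.
move: hA hb hc; rewrite !le_min.
move=> /andP[Ae _] /and3P[_ bd _] /and3P[_ _ cd].
exists A1, (b *m intv P), (c *m intv Q), (c *m 0 + g *m intv P), s, t.
split; split => //.
- exact: reach_trans (reach_diag _ uP uQ) r.
- by rewrite scalemxAl; apply: hd => //; rewrite subrr normr0 ltW.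
- by rewrite scalemxAl; apply: hd' => //; rewrite subrr normr0 ltW.
Qed.

(** The integer change of coordinates is made after the move: A1 being near 0, so is P A1 Q^-1. *)
Lemma steerable_intl m n (B : 'M[R]_m) (C : 'M[R]_n) (P : 'M[int]_m) (Q : 'M[int]_n) :
  P \in unitmx -> Q \in unitmx -> steerable B C ->
  steerable (intv P *m B) (intv Q *m C).
Proof.
move=> uP uQ h A e e0.
have [d d0 hd] := mx_norm_mul_near (intv P) B e0.
have [d' d'0 hd'] := mx_norm_mul_near (intv Q) C e0.
have [d1 d10 hd1] := mx_norm_mul_near (intv P) (0 : 'M[R]_(m, n)) e0.
have [d2 d20 hd2] := mx_norm_mul_near (0 : 'M[R]_(m, n)) (invmx (intv Q)) e0.
have [d3 d30 hd3] := mx_norm_mul_near (intv P) (0 : 'M[R]_(m, n)) d20.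
have f0 : 0 < Num.min d3 (Num.min d d') by rewrite !lt_min d30 d0.
have [A1 [b [c [g [s [t [[r s0 t0] [hA hb hc]]]]]]]] := h A _ f0.
move: hA hb hc; rewrite !le_min.
move=> /andP[Ae _] /and3P[_ bd _] /and3P[_ _ cd].
exists (intv P *m A1 *m invmx (intv Q)), (intv P *m b), (intv Q *m c),
  (intv Q *m g + 0 *m b), s, t.
split; split => //.
- exact: reach_trans r (reach_diag _ uP uQ).
- have := hd2 (intv P *m A1) (invmx (intv Q)).
  rewrite mul0mx !subr0; apply; last by rewrite subrr normr0 ltW.
  have := hd3 (intv P) A1; rewrite mulmx0 !subr0; apply => //.
  by rewrite subrr normr0 ltW.
- by rewrite scalemxAr; apply: hd => //; rewrite subrr normr0 ltW.
- by rewrite scalemxAr; apply: hd' => //; rewrite subrr normr0 ltW.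
Qed.

End Reach.

(** * Block factorisations of W and the duality between m and n *)

Section LDU.
Variable R : realType.

(* W is [1 -u; 0 1] [P 0; 0 Q] [1 0; -l 1]. The condition does not involve A: when
   P, Q^-1, u and l are small, c = Q (1 - l A) and b is nearly P. *)
Definition asymptotic_ldu m n (B : 'M[R]_m) (C : 'M[R]_n) : Prop :=
  forall e : R, 0 < e -> exists (W : 'M[int]_(m + n)) P Q u l (s t : R),
  [/\ W \in unitmx, P \in unitmx, Q \in unitmx &
      intv W = block_mx (P + u *m Q *m l) (- (u *m Q)) (- (Q *m l)) Q] /\
  [/\ s != 0, t != 0, `|P| <= e & `|invmx Q| <= e] /\
  [/\ `|u| <= e, `|l| <= e, `|s *: P - B| <= e & `|t *: Q - C| <= e].

(** With Z = (1 - l A)^-1 one finds A' = P A Z Q^-1 - u, which is small with P, Q^-1 and u, and b =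
    P (1 + A Z l). *)
Lemma asymptotic_ldu_steerable m n (B : 'M[R]_m) (C : 'M[R]_n) :
  asymptotic_ldu B C -> steerable B C.
Proof.
move=> h A e e0.
have [d d0 hd] := mx_norm_mul_near B 1%:M e0.
have [d' d'0 hd'] := mx_norm_mul_near C 1%:M e0.
have [v v0 hv] := invmx_near (unitmx1 R n) (ltr01 : 0 < 1 :> R).
(* k bounds the dimensions, a the norm of A and z that of (1 - l A)^-1. The perturbations estimated
   below are at most f times a product of these that K dominates. *)
pose k : R := m%:R + n%:R + 1; pose a := `|A| + 1; pose z := `|1%:M : 'M[R]_n| + 1.
have k1 : 1 <= k by rewrite lerDr addr_ge0.
have a1 : 1 <= a by rewrite lerDr.
have z1 : 1 <= z by rewrite lerDr.
have km : m%:R <= k by rewrite /k -addrA lerDl addr_ge0.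
have kn : n%:R <= k by rewrite /k addrAC lerDr addr_ge0.
have [k0 a0 z0] : [/\ 0 <= k, 0 <= a & 0 <= z].
  by rewrite !(le_trans ler01).
pose K := k * (k * a * (k * z)) + 1.
have K1 : 0 < K by rewrite ltr_wpDl // !mulr_ge0.
pose f := Num.min 1 (Num.min e (Num.min d (Num.min d' v)) / K).
have f0 : 0 < f.
  by rewrite lt_min ltr01 divr_gt0 // !lt_min e0 d0 d'0.
have f1 : f <= 1 by rewrite ge_min lexx.
have : f * K <= Num.min e (Num.min d (Num.min d' v)).
  by rewrite -ler_pdivlMr // ge_min lexx orbT.
rewrite !le_min => /and4P[fe fd fd' fv].
have fK x : x <= k * (k * a * (k * z)) -> f * x <= f * K.
  by move=> hx; rewrite ler_wpM2l ?(ltW f0) // (le_trans hx) // lerDl.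
have Kf : f <= f * K by rewrite ler_peMr ?(ltW f0) // lerDr !mulr_ge0.
have {}h := h _ f0.
have [W [P [Q [u [l [s [t h1]]]]]]] := h.
move: h1 => [[uW uP uQ WE] [[s0 t0 hP hQ] [hu hl hB hC]]].
have nA : `|A| <= a by rewrite lerDl.
pose E := - (l *m A).
have hE : `|E| <= f * K.
  rewrite normrN (le_trans (mx_norm_mul_le km hl nA)) //.
  have -> : k * f * a = f * (k * a) by ring.
  apply: fK; have -> : k * (k * a * (k * z)) = k * a * (k * (k * z)) by ring.
  by rewrite ler_peMr ?mulr_ege1 ?mulr_ge0.
have [uE hZ] : 1%:M + E \in unitmx /\ `|invmx (1%:M + E) - invmx 1%:M| <= 1.
  by apply: hv; rewrite addrC addKr (le_trans hE).
set Z := invmx (1%:M + E) in hZ.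
have nZ : `|Z| <= z.
  rewrite -(subrK 1%:M Z) (le_trans (ler_normD _ _)) // addrC lerD2l.
  by rewrite -[in X in X <= _]invmx1.
have cE : - (Q *m l) *m A + Q = Q *m (1%:M + E).
  by rewrite mulmxDr mulmx1 mulmxN mulNmx mulmxA addrC.
have uc : - (Q *m l) *m A + Q \in unitmx by rewrite cE unitmx_mul uQ.
have := reach_moebius uW WE uc; rewrite /= cE.
set A' := _ *m invmx _ => r.
have A'E : A' = P *m (A *m (Z *m invmx Q)) - u.
  have u1 : Q *m (1%:M + E) \in unitmx by rewrite unitmx_mul uQ.
  apply: (can_inj (mulmxK u1)); rewrite /A' mulmxKV // !mulmxBl !mulmxA.
  rewrite mulmxKV // mulmxKV // mulmxDl /E mulmxDr mulmx1 mulmxN !mulmxA.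
  by rewrite opprB addrA addrAC.
have bE : P + u *m Q *m l - A' *m (- (Q *m l)) = P *m (1%:M + A *m Z *m l).
  rewrite A'E mulmxN opprK mulmxBl !mulmxA mulmxKV // mulmxDr mulmx1 !mulmxA.
  by rewrite addrACA subrr addr0.
have nu : `|A *m Z *m l| <= f * K.
  have h1 : `|A *m Z *m l| <= k * (k * a * z) * f.
    by apply: mx_norm_mul_le => //; exact: mx_norm_mul_le.
  rewrite (le_trans h1) // [k * _ * f]mulrC; apply: fK.
  by rewrite ler_wpM2l // ler_wpM2l ?mulr_ge0 // ler_peMl.
move: r; rewrite bE => r.
exists A', (P *m (1%:M + A *m Z *m l)), (Q *m (1%:M + E)), (- (Q *m l)), s, t.
split; split => //.
- rewrite A'E (le_trans (ler_normB _ _)) //.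
  have h2 : `|P *m (A *m (Z *m invmx Q))| <= k * f * (k * a * (k * z * f)).
    by do 3 apply: mx_norm_mul_le => //.
  apply: (@le_trans _ _ (f * (k * (k * a * (k * z))) + f)).
    apply: lerD => //; apply: le_trans h2 _.
    have -> : k * f * (k * a * (k * z * f)) = f * (k * (k * a * (k * z))) * f by ring.
    by rewrite ler_piMr // !mulr_ge0 // ltW.
  by rewrite -[X in _ + X]mulr1 -mulrDr.
- rewrite scalemxAl -[B]mulmx1; apply: hd; first by rewrite (le_trans hB) // (le_trans Kf).
  by rewrite addrC addKr (le_trans nu).
- rewrite scalemxAl -[C]mulmx1; apply: hd'; first by rewrite (le_trans hC) // (le_trans Kf).
  by rewrite addrC addKr (le_trans hE).
Qed.

(** Conjugation by the permutation that exchanges the two blocks of coordinates, hence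
    multiplicative. *)
Definition swap_mx (T : Type) m n (M : 'M[T]_(m + n)) : 'M[T]_(n + m) :=
  block_mx (drsubmx M) (dlsubmx M) (ursubmx M) (ulsubmx M).

Lemma swap_mx_mul (T : pzRingType) m n (M N : 'M[T]_(m + n)) :
  swap_mx (M *m N) = swap_mx M *m swap_mx N.
Proof.
rewrite -[M]submxK -[N]submxK mulmx_block /swap_mx !block_mxKul !block_mxKur
  !block_mxKdl !block_mxKdr mulmx_block.
by congr block_mx; rewrite addrC.
Qed.

Lemma swap_mx1 (T : pzRingType) m n : swap_mx (1%:M : 'M[T]_(m + n)) = 1%:M.
Proof.
by rewrite /swap_mx scalar_mx_block !block_mxKul !block_mxKur !block_mxKdl
  !block_mxKdr -scalar_mx_block.
Qed.

Lemma invmx_scale n (M : 'M[R]_n) (t : R) : t != 0 -> M \in unitmx ->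
  invmx (t *: M) = t^-1 *: invmx M.
Proof. by move=> t0 uM; rewrite invmxZ // unitmxZ // unitfE. Qed.

(** The inverse of W is [1 0; l 1] [P^-1 0; 0 Q^-1] [1 u; 0 1]. Exchanging the blocks restores the
    required shape, with Q^-1, P^-1, -l, -u in the places of P, Q, u, l; smallness of P and of Q^-1
    trade places. *)
Lemma asymptotic_ldu_swap m n (B : 'M[R]_m) (C : 'M[R]_n) :
  B \in unitmx -> C \in unitmx ->
  asymptotic_ldu B C -> asymptotic_ldu (invmx C) (invmx B).
Proof.
move=> uB uC h e e0.
have [d d0 hd] := invmx_near uB e0; have [d' d'0 hd'] := invmx_near uC e0.
have f0 : 0 < Num.min e (Num.min d d') by rewrite !lt_min e0 d0.
have [W [P [Q [u [l [s [t h1]]]]]]] := h _ f0.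
move: h1; rewrite !le_min => -[[uW uP uQ WE] [[s0 t0 /andP[hP _] /andP[hQ _]]
  [/andP[hu _] /andP[hl _] /and3P[_ hB _] /and3P[_ _ hC]]]].
have VE : intv (invmx W) =
    block_mx (invmx P) (invmx P *m u) (l *m invmx P) (invmx Q + l *m invmx P *m u).
  have uWR := intv_unitmx R uW.
  apply: (can_inj (mulKmx uWR)); rewrite intv_mulV // WE mulmx_block.
  rewrite scalar_mx_block; congr block_mx.
  - by rewrite mulmxDl mulmxV // !mulNmx !mulmxA addrK.
  - rewrite mulmxDr mulmxDl !mulNmx !mulmxA mulmxV // mul1mx mulmxK //.
    by rewrite addrACA !subrr addr0.
  - by rewrite mulNmx !mulmxA addNr.
  - by rewrite mulmxDr mulNmx !mulmxA mulmxV // addrCA addNr addr0.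
exists (swap_mx (invmx W)), (invmx Q), (invmx P), (- l), (- u), t^-1, s^-1.
rewrite !unitmx_inv !invmxK !normrN !invr_eq0 -!invmx_scale //.
split; split => //; last by split => //; [case: (hd' _ hC)|case: (hd _ hB)].
- have : swap_mx (invmx W) *m swap_mx W = 1%:M by rewrite -swap_mx_mul mulVmx // swap_mx1.
  by move=> /mulmx1_unit[].
- rewrite /swap_mx map_block_mx map_drsubmx map_dlsubmx map_ursubmx map_ulsubmx VE.
  rewrite !block_mxKul !block_mxKur !block_mxKdl !block_mxKdr.
  by rewrite !mulNmx !mulmxN !opprK.
Qed.

End LDU.

(** * A unimodular family *)

Section Bidiagonal.

Definition bidiag_mx (T : pzRingType) n (k : T) (a : 'I_n.+1 -> T) : 'M[T]_n.+1 :=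
  \matrix_(i, j) (k * a i *+ (i == j) + (i == j.+1 :> nat)%:R).

(** Deleting the first row and the last column leaves a triangular matrix whose diagonal consists of
    the subdiagonal ones. *)
Lemma bidiag_adj (T : comPzRingType) n (k : T) (a : 'I_n.+1 -> T) :
  (\adj (bidiag_mx k a)) ord_max ord0 = (-1) ^+ n.
Proof.
rewrite mxE /cofactor add0n -det_tr det_trig.
  rewrite big1 ?mulr1 // => i _; rewrite !mxE /= /bump !leq0n !add1n.
  rewrite leqNgt ltn_ord add0n eqxx -val_eqE /= /bump leq0n add1n leqNgt ltn_ord add0n.
  by rewrite gtn_eqF // add0r.
apply/is_trig_mxP => i j ij; rewrite !mxE -val_eqE /= /bump !leq0n !add1n.
have -> : (n <= i)%N = false by apply/negbTE; rewrite -ltnNge; exact: (ltn_ord i).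
rewrite add0n eqSS !gtn_eqF ?addr0 //.
by rewrite ltnS ltnW.
Qed.

Lemma det_bidiag (T : comPzRingType) n (k : T) (a : 'I_n.+1 -> T) :
  \det (bidiag_mx k a) = \prod_i (k * a i).
Proof.
rewrite det_trig; first by apply: eq_bigr => i _; rewrite mxE eqxx ltn_eqF // addr0.
apply/is_trig_mxP => i j ij; rewrite mxE -val_eqE ltn_eqF // ltn_eqF ?addr0 //.
by rewrite ltnS ltnW.
Qed.

Variable R : realType.

Lemma intv_bidiag n (k : int) (a : 'I_n.+1 -> int) :
  intv (bidiag_mx k a) = bidiag_mx (k%:~R : R) (fun i => (a i)%:~R).
Proof.
by apply/matrixP => i j; rewrite !mxE rmorphD /= rmorphMn /= rmorphM /= rmorph_nat.
Qed.

Lemma intv_exp n (M : 'M[int]_n.+1) p : intv (M ^+ p) = (intv M : 'M[R]_n.+1) ^+ p.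
Proof.
elim: p => [|p IH]; first by rewrite !expr0 map_mx1.
by rewrite !exprS map_mxM /= IH.
Qed.

Section Base.
Variables (m n : nat) (a : 'I_n.+1 -> int).
Hypothesis (a0 : forall i, a i != 0).

Let Y (k : R) : 'M[R]_n.+1 := bidiag_mx k (fun i => (a i)%:~R).

Let unitY k : k != 0 -> Y k \is a GRing.unit.
Proof.
move=> k0; change (Y k \in unitmx); rewrite unitmxE det_bidiag unitfE.
by apply/prodf_neq0 => i _; rewrite mulf_neq0 // intr_eq0.
Qed.

Let grad k := diag_mx (\row_(i < n.+1) (k ^- i : R)).
Let gradV k := diag_mx (\row_(i < n.+1) (k ^+ i : R)).

Let gradK k : k != 0 -> gradV k * grad k = 1.
Proof.
move=> k0; change (gradV k *m grad k = 1%:M).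
rewrite mulmx_diag -diag_const_mx; congr diag_mx; apply/rowP => i.
by rewrite !mxE mulfV // expf_neq0.
Qed.

Let gradKV k : k != 0 -> grad k * gradV k = 1.
Proof. by move=> k0; apply: mulmx1C; exact: gradK. Qed.

(* Grading by powers of k. *)
Let YE1 k : k != 0 -> Y k = k *: (grad k * Y 1 * gradV k).
Proof.
move=> k0; rewrite -[grad k * _]/(grad k *m _) -[_ * gradV k]/(_ *m gradV k).
apply/matrixP => i j; rewrite mul_mx_diag mul_diag_mx /Y !mxE mul1r mulrDr mulrDl mulrDr.
congr (_ + _).
  have [->|_] := eqVneq i j; last by rewrite !mulr0n mulr0 mul0r mulr0.
  by rewrite !mulr1n; congr (k * _); rewrite mulrAC mulVf ?mul1r // expf_neq0.
have [->|_] := eqVneq (i : nat) j.+1; last by rewrite mulr0 mul0r mulr0.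
by rewrite mulr1 exprS invfM !mulrA mulfV // mul1r mulVf // expf_neq0.
Qed.

Let YE k p : k != 0 -> Y k ^+ p = k ^+ p *: (grad k * Y 1 ^+ p * gradV k).
Proof.
move=> k0; elim: p => [|p IH].
  by rewrite !expr0 scale1r mulr1 gradKV.
rewrite exprS IH {1}YE1 // -scalerAl -scalerAr scalerA -exprS; congr (_ *: _).
by rewrite exprS !mulrA -(mulrA _ (gradV k)) gradK // mulr1.
Qed.

Let Yinv_entry k p i j : k != 0 ->
  (Y k ^- p) i j = k ^- p * (k ^- i * (Y 1 ^- p) i j * k ^+ j).
Proof.
move=> k0; have u1 := unitrX p (unitY (oner_neq0 R)).
have -> : Y k ^- p = k ^- p *: (grad k * Y 1 ^- p * gradV k).
  apply: (mulrI (unitrX p (unitY k0))); rewrite mulrV ?unitrX ?unitY //.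
  rewrite (YE p k0) -scalerAl -scalerAr scalerA mulfV ?expf_neq0 // scale1r.
  rewrite !mulrA -(mulrA _ (gradV k)) gradK // mulr1.
  by rewrite -(mulrA _ _ (_ ^-1)) mulrV // mulr1 gradKV.
rewrite -[grad k * _]/(grad k *m _) -[_ * gradV k]/(_ *m gradV k).
by rewrite mxE mul_mx_diag mul_diag_mx !mxE.
Qed.

Let c0 : R := \sum_(p < m.+1) `|Y 1 ^- p|.

Let c0_ge p (i j : 'I_n.+1) : (p <= m)%N -> `|(Y 1 ^- p) i j| <= c0.
Proof.
move=> pm; apply: le_trans (mx_entry_le _ _ _) _.
have pm' : (p < m.+1)%N by [].
by rewrite /c0 (bigD1 (Ordinal pm')) //= lerDl sumr_ge0.
Qed.

(** By the grading the exponent of k in this entry is - p - (i - j), which is at most -1; c0 does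
    not depend on k. *)
Let Yinv_entry_le k p (i j : 'I_n.+1) : 1 <= k -> (0 < p)%N -> (p <= m)%N -> (j <= i)%N ->
  `|(Y k ^- p) i j| <= c0 / k.
Proof.
move=> k1 p0 pm ji; have k0 : 0 < k by exact: lt_le_trans k1.
rewrite Yinv_entry ?gt_eqF // [c0 / k]mulrC normrM ler_pM //.
  rewrite ger0_norm ?invr_ge0 ?exprn_ge0 ?(ltW k0) // lef_pV2 ?posrE ?exprn_gt0 //.
  by rewrite ler_eXnr.
have -> : k ^- i * (Y 1 ^- p) i j * k ^+ j = (Y 1 ^- p) i j / k ^+ (i - j).
  rewrite -{1}(subnK ji) exprD invfM; field.
  by rewrite !expf_neq0 ?gt_eqF.
rewrite normrM -[leRHS]mulr1 ler_pM //.
  exact: c0_ge.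
rewrite ger0_norm ?invr_ge0 ?exprn_ge0 ?(ltW k0) //.
by rewrite invf_le1 ?exprn_gt0 // exprn_ege1.
Qed.

(** The source of unimodularity: in the construction below det P and det Q are the m-th powers of
    minus this corner entry and of det (Y k). *)
Let last_entry k : k != 0 -> (Y k)^-1 ord_max ord0 * \det (Y k) = (-1) ^+ n.
Proof.
move=> k0; have d0 : \det (Y k) \is a GRing.unit.
  by rewrite -unitmxE; exact: unitY.
rewrite -(bidiag_adj k (fun i => (a i)%:~R)) -/(Y k) -[(Y k)^-1]/(invmx (Y k)) /invmx.
have -> : Y k \in unitmx by exact: unitY.
by rewrite mxE mulrC mulrA mulrV // mul1r.
Qed.

Let mulYVr k p q : k != 0 -> (p <= q)%N -> Y k ^+ p * Y k ^- q = Y k ^- (q - p).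
Proof.
move=> k0 pq; have uY := unitY k0; apply: (mulIr (unitrX q uY)).
have E : Y k ^+ q = Y k ^+ (q - p) * Y k ^+ p by rewrite -exprD subnK.
by rewrite mulrVK ?unitrX // [X in _ = _ * X]E mulKr ?unitrX.
Qed.

Let mulYVl k p q : k != 0 -> (p <= q)%N -> Y k ^- q * Y k ^+ p = Y k ^- (q - p).
Proof.
move=> k0 pq; have uY := unitY k0; apply: (mulrI (unitrX q uY)).
have E : Y k ^+ q = Y k ^+ p * Y k ^+ (q - p) by rewrite -exprD subnKC.
by rewrite mulVKr ?unitrX // [X in _ = X * _]E mulrK ?unitrX.
Qed.

Let mulYVp k p q : k != 0 -> (q <= p)%N -> Y k ^+ p * Y k ^- q = Y k ^+ (p - q).
Proof.
move=> k0 pq; have uY := unitY k0; apply: (mulIr (unitrX q uY)).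
by rewrite mulrVK ?unitrX // -exprD subnK.
Qed.

(* Put f_j = \prod_(l > j) (X - k a_l) and F = \prod_l (X - k a_l). The rows of the
   matrix W below expand the polynomials X^i (i < m) and X^m f_j (j <= n) in the
   basis F X^i (i < m), f_j (j <= n), which explains why W is unimodular; Y k is
   the multiplication by X modulo F. *)
Lemma asymptotic_ldu_bidiag : (0 < m)%N ->
  exists2 e : R, e != 0 & asymptotic_ldu (e%:M : 'M[R]_m)
    (diag_mx (\row_i (a i)%:~R) ^+ m : 'M[R]_n.+1).
Proof.
move=> m0; set D := diag_mx _.
(* The diagonal entries of P will be - (Y k)^-1 at the corner, that is k^-(n+1) e by the grading;
   the scalar for P is therefore k^(n+1). *)
pose e := - (Y 1)^-1 ord_max ord0.
have e0 : e != 0.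
  rewrite oppr_eq0; apply/eqP => h.
  by have /eqP := last_entry (oner_neq0 R); rewrite h mul0r eq_sym signr_eq0.
exists e => // f f0.
have uC : D ^+ m \in unitmx.
  apply: (@unitrX _ D m); change (D \in unitmx); rewrite unitmxE det_diag unitfE.
  by apply/prodf_neq0 => i _; rewrite mxE intr_eq0.
have [d1 d10 hd1] := invmx_near uC (ltr01 : 0 < 1 :> R).
have fd1 : 0 < Num.min f d1 by rewrite lt_min f0.
have [d2 d20 hd2] := expmx_near D m fd1.
(* c0 serves for P, u and l, the norm of the inverse of D^m plus 1 for Q^-1, and 1 for the distance
   from Y / k to D. *)
pose K := c0 + `|invmx (D ^+ m)| + 1.
have c00 : 0 <= c0 by rewrite sumr_ge0.
have K1 : 1 <= K by rewrite lerDr addr_ge0.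
have fd2 : 0 < Num.min f d2 by rewrite lt_min f0.
pose N := (Num.bound (K / Num.min f d2)).+1; pose k : R := N%:R.
have k1 : 1 <= k by rewrite ler1n.
have k0 : 0 < k by exact: lt_le_trans k1.
have kn0 : k != 0 by rewrite gt_eqF.
have : K / k <= Num.min f d2.
  rewrite ler_pdivrMr // mulrC -ler_pdivrMr // /k /N.
  rewrite (le_trans (ltW (archi_boundP _))) ?divr_ge0 ?(ltW fd2) //.
    by rewrite (le_trans ler01).
  by rewrite ler_nat.
rewrite le_min => /andP[Kf Kd].
have le_f x : x <= K -> x / k <= f.
  by move=> xK; apply: le_trans Kf; rewrite ler_wpM2r // invr_ge0 ltW.
have c0f : c0 / k <= f by apply: le_f; rewrite /K -addrA lerDl addr_ge0.
pose Yi : 'M[int]_n.+1 := bidiag_mx N%:Z a.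
have YiE : intv Yi = Y k by rewrite intv_bidiag.
have uY := unitY kn0.
pose etai : 'M[int]_m := \matrix_(i, j) (if (j < i)%N then (Yi ^+ (i - j.+1)) ord_max ord0 else 0).
pose xii : 'M[int]_(m, n.+1) := \matrix_(i, j) (Yi ^+ i) ord_max j.
pose kapi : 'M[int]_(n.+1, m) := \matrix_(i, j) (Yi ^+ (m - j.+1)) i ord0.
pose W := block_mx etai xii kapi (Yi ^+ m).
pose Q := Y k ^+ m.
have uQ : Q \in unitmx by exact: unitrX.
have QE : intv (Yi ^+ m) = Q by rewrite intv_exp YiE.
have xiE M i j : ((intv xii : 'M[R]_(m, n.+1)) *m M) i j = (Y k ^+ i *m M) ord_max j :> R.
  rewrite -YiE -intv_exp !mxE; apply: eq_bigr => l _; by rewrite !mxE.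
have kapE p (M : 'M[R]_(p, n.+1)) i j : (M *m (intv kapi : 'M[R]_(n.+1, m))) i j =
    (M *m Y k ^+ (m - j.+1)) i ord0 :> R.
  rewrite -YiE -intv_exp !mxE; apply: eq_bigr => l _; by rewrite !mxE.
have etaE i j : (intv etai : 'M[R]_m) i j =
    if (j < i)%N then (Y k ^+ (i - j.+1)) ord_max ord0 else 0.
  by rewrite !mxE; case: ifP => _; rewrite -?YiE -?intv_exp ?mxE.
pose u := - (intv xii *m invmx Q); pose l := - (invmx Q *m intv kapi).
(* The Schur complement of Q in W. *)
pose P := intv etai - intv xii *m invmx Q *m intv kapi.
have WE : intv W = block_mx (P + u *m Q *m l) (- (u *m Q)) (- (Q *m l)) Q.
  rewrite map_block_mx QE; congr block_mx.
  - by rewrite /u mulNmx mulmxKV // /l mulmxN mulNmx opprK mulmxA subrK.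
  - by rewrite /u mulNmx mulmxKV // opprK.
  - by rewrite /l mulmxN mulKVmx // opprK.
have uEnt i j : `|u i j| <= c0 / k.
  rewrite mxE normrN xiE -[_ *m _]/(_ * _) mulYVr ?(ltnW (ltn_ord i)) //.
  by apply: Yinv_entry_le; rewrite ?subn_gt0 ?leq_subr // -ltnS.
have QkE j : invmx Q *m Y k ^+ (m - j.+1) = Y k ^- (m - (m - j.+1)).
  by rewrite -[LHS]/(Y k ^- m * Y k ^+ (m - j.+1)) mulYVl // leq_subr.
have lEnt i' j' : `|l i' j'| <= c0 / k.
  rewrite mxE normrN kapE QkE subKn //.
  by apply: Yinv_entry_le.
(* The (i, j) entry of xi Q^-1 kap is the corner entry of Y^(i - j - 1). The block [etai] cancels it
   when the exponent is nonnegative, so P is upper triangular with only negative powers of Y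
   left. *)
have PE i j : P i j = if (i <= j)%N then - (Y k ^- (j - i).+1) ord_max ord0 else 0.
  rewrite mxE [X in _ + X]mxE kapE -mulmxA xiE QkE subKn // etaE -[_ *m _]/(_ * _).
  have [ij|ji] := leqP i j.
    by rewrite mulYVr ?(leq_trans ij) // add0r subSn.
  by rewrite mulYVp // subrr.
have detP : \det P = (- (Y k)^-1 ord_max ord0) ^+ m.
  rewrite -det_tr det_trig; last first.
    by apply/is_trig_mxP => i j ij; rewrite mxE PE leqNgt ij.
  rewrite (eq_bigr (fun=> - (Y k)^-1 ord_max ord0)); last first.
    by move=> i _; rewrite mxE PE leqnn subnn expr1.
  by rewrite prodr_const card_ord.
have detQ : \det Q = \det (Y k) ^+ m.
  rewrite /Q; elim: (m) => [|p IH]; first by rewrite !expr0 det1.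
  by rewrite !exprS det_mulmx IH.
have detPQ : `|\det P * \det Q| = 1.
  rewrite detP detQ -exprMn mulNr last_entry // normrX normrN normrX normrN1.
  by rewrite !expr1n.
have detW : `|\det (intv W : 'M[R]_(m + n.+1))| = 1.
  have -> : intv W = block_mx 1%:M (- u) 0 1%:M *m block_mx P 0 (- (Q *m l)) Q.
    rewrite WE; move: (u) (l) => u' l'.
    rewrite mulmx_block !mul1mx !mulmx0 !mul0mx !add0r mulNmx mulmxN opprK.
    by rewrite mulmxA mulNmx.
  by rewrite det_mulmx det_ublock det_lblock !det1 !mul1r.
have uW : W \in unitmx.
  move: detW; rewrite det_map_mx -intr_norm => /eqP.
  rewrite -[1]/(1%:~R) eqr_int unitmxE; move: (\det W) => z.
  by have [z0|z0] := leP 0 z; rewrite ?(ger0_norm z0) ?(ltr0_norm z0) ?eqr_oppLR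
    => /eqP ->.
have uP : P \in unitmx.
  rewrite unitmxE unitfE; apply/eqP => h.
  by move/eqP: detPQ; rewrite h mul0r normr0 eq_sym oner_eq0.
have c0k : 0 <= c0 / k by rewrite divr_ge0 // ltW.
(* Y / k differs from D by entries 1 / k on the subdiagonal. *)
have tQ : `|k ^- m *: Q - D ^+ m| <= Num.min f d1.
  have -> : k ^- m *: Q = (k^-1 *: Y k) ^+ m by rewrite exprZn exprVn.
  apply: hd2; apply: le_trans Kd; apply: mx_norm_le => [|i j].
    by rewrite divr_ge0 ?(ltW k0) // (le_trans ler01).
  rewrite !mxE mulrDr mulrnAr mulKf // [X in `|X|]addrAC.
  rewrite subrr add0r mulrC normrM normfV (gtr0_norm k0) ler_wpM2r ?invr_ge0 ?(ltW k0) //.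
  by rewrite normr_nat (le_trans _ K1) // lern1 leq_b1.
move: tQ; rewrite le_min => /andP[tQf tQ1].
exists W, P, Q, u, l, (k ^+ n.+1), (k ^- m).
split; [by split|split; split => //].
- by rewrite expf_neq0.
- by rewrite invr_eq0 expf_neq0.
- apply: mx_norm_le => [|i j]; first exact: ltW.
  rewrite PE; case: ifP => [ij|_]; last by rewrite normr0 ltW.
  rewrite normrN (le_trans _ c0f) // Yinv_entry_le //.
  by rewrite (leq_ltn_trans (leq_subr _ _)).
- have [utQ hQ] := hd1 _ tQ1.
  have -> : invmx Q = k ^- m *: invmx (k ^- m *: Q).
    by rewrite invmx_scale ?invr_eq0 ?expf_neq0 // scalerA invrK mulVf ?expf_neq0 // scale1r.
  rewrite normrZ mulrC (le_trans _ (le_f (`|invmx (D ^+ m)| + 1) _)) //; last first.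
    by rewrite /K -addrA lerDr.
  rewrite ler_pM //.
    by rewrite -(subrK (invmx (D ^+ m)) (invmx (_ *: _))) (le_trans (ler_normD _ _)) // addrC lerD2l.
  rewrite ger0_norm ?invr_ge0 ?exprn_ge0 ?(ltW k0) // lef_pV2 ?posrE ?exprn_gt0 //.
  by rewrite ler_eXnr.
- by apply: mx_norm_le => [|i j]; [exact: ltW|exact: le_trans (uEnt i j) _].
- by apply: mx_norm_le => [|i j]; [exact: ltW|exact: le_trans (lEnt i j) _].
- apply: mx_norm_le => [|i j]; first exact: ltW.
  have -> : (k ^+ n.+1 *: P - e%:M) i j = k ^+ n.+1 * P i j - e *+ (i == j).
    by move: (P) => P'; rewrite !mxE.
  rewrite PE; case: ltngtP => [ij|ij|/val_inj ->].
  + have -> : (i == j) = false by rewrite -val_eqE ltn_eqF.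
    rewrite mulr0n subr0 (le_trans _ c0f) // Yinv_entry //=.
    have -> : k ^+ n.+1 * - (k ^- (j - i).+1 * (k ^- n *
        (Y 1 ^- (j - i).+1) ord_max ord0 * k ^+ 0)) =
        - ((Y 1 ^- (j - i).+1) ord_max ord0 * k ^- (j - i)).
      by rewrite expr0 !exprS; field; rewrite kn0 !expf_neq0.
    rewrite normrN normrM ler_pM //.
      apply: c0_ge; exact: leq_ltn_trans (leq_subr _ _) (ltn_ord j).
    rewrite ger0_norm ?invr_ge0 ?exprn_ge0 ?(ltW k0) // lef_pV2 ?posrE ?exprn_gt0 //.
    by rewrite ler_eXnr // subn_gt0.
  + have -> : (i == j) = false by rewrite -val_eqE gtn_eqF.
    by rewrite mulr0 mulr0n subr0 normr0 ltW.
  + rewrite eqxx mulr1n subnn Yinv_entry //= /e !expr1 expr0.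
    have -> : k ^+ n.+1 * - (k^-1 * (k ^- n * (Y 1)^-1 ord_max ord0 * 1)) =
        - (Y 1)^-1 ord_max ord0.
      by rewrite !exprS; field; rewrite kn0 expf_neq0.
    by rewrite subrr normr0 ltW.
Qed.
End Base.
End Bidiagonal.

(** * Density *)

Section Density.
Variable R : realType.

Lemma diag_mx_exp n (x : 'I_n.+1 -> R) p :
  (diag_mx (\row_i x i) : 'M[R]_n.+1) ^+ p = diag_mx (\row_i x i ^+ p).
Proof.
elim: p => [|p IH].
  rewrite expr0 -[RHS]/(diag_mx _); apply/matrixP => i j; rewrite !mxE expr0 //.
rewrite exprS IH -[LHS]/(_ *m _) mulmx_diag; congr diag_mx.
by apply/rowP => i; rewrite !mxE exprS.
Qed.

Lemma archi_bound_inv (d : R) : 0 < d -> ((Num.bound d^-1).+1%:R)^-1 <= d.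
Proof.
move=> d0; rewrite -[leRHS]invrK lef_pV2 ?posrE ?invr_gt0 //.
by rewrite (le_trans (ltW (archi_boundP _))) ?invr_ge0 ?(ltW d0) // ler_nat.
Qed.

(** The available matrices have p-th powers of integers on the diagonal: approximate the p-th roots
    of the x i by fractions with a common denominator. *)
Lemma diag_mx_power_approx n p (x : 'I_n.+1 -> R) (e : R) : (0 < p)%N -> 0 < e ->
  (forall i, 0 < x i) -> exists (a : 'I_n.+1 -> int) (r : R),
    [/\ forall i, a i != 0, r != 0 &
        `|r *: diag_mx (\row_i (a i)%:~R) ^+ p - diag_mx (\row_i x i)| <= e].
Proof.
move=> p0 e0 x0; pose y i := x i `^ p%:R^-1.
have yp i : y i ^+ p = x i.
  by rewrite -powR_mulrn ?powR_ge0 // -powRrM mulVf ?pnatr_eq0 -?lt0n // powRr1 ?ltW.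
have [d d0 hd] := expmx_near (diag_mx (\row_i y i)) p e0.
pose N := (Num.bound d^-1).+1; pose k : R := N%:R.
have k0 : 0 < k by rewrite ltr0n.
have kd : k^-1 <= d := archi_bound_inv d0.
(* Adding 1 keeps the integers nonzero and the error at most 1 / k. *)
exists (fun i => Num.floor (k * y i) + 1), (k ^- p); split.
- move=> i; rewrite gt_eqF // ltr_wpDl // floor_ge0 mulr_ge0 ?powR_ge0 ?ltW //.
- by rewrite invr_eq0 expf_neq0 // gt_eqF.
- have -> : diag_mx (\row_i x i) = diag_mx (\row_i y i) ^+ p.
    by rewrite diag_mx_exp; congr diag_mx; apply/rowP => i; rewrite !mxE yp.
  rewrite -exprVn -exprZn; apply: hd; apply: le_trans kd.
  apply: mx_norm_le => [|i j]; first by rewrite invr_ge0 ltW.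
  rewrite !mxE; have [_|_] := eqVneq i j; last first.
    by rewrite !mulr0n mulr0 subrr normr0 invr_ge0 ltW.
  rewrite !mulr1n.
  have -> : k^-1 * (Num.floor (k * y i) + 1)%:~R - y i =
      k^-1 * ((Num.floor (k * y i) + 1)%:~R - k * y i).
    by rewrite mulrBr mulKf // gt_eqF.
  rewrite normrM ger0_norm ?invr_ge0 ?(ltW k0) // ler_piMr ?invr_ge0 ?(ltW k0) //.
  have := floor_le (k * y i); have := floorD1_gt (k * y i).
  rewrite intrD ler_norml; set z := (Num.floor _)%:~R; move=> h1 h2.
  by apply/andP; split; lra.
Qed.

Lemma steerable_diagr m n (x : 'I_n -> R) : (0 < m)%N -> (0 < n)%N ->
  (forall i, 0 < x i) -> steerable (1%:M : 'M[R]_m) (diag_mx (\row_i x i)).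
Proof.
case: n x => // n x m0 _ x0; apply: steerable_lim => e e0.
have [a [r [a0 r0 h]]] := diag_mx_power_approx m0 e0 x0.
have [f f0 /asymptotic_ldu_steerable st] := @asymptotic_ldu_bidiag R m n a a0 m0.
exists 1%:M, (r *: diag_mx (\row_i (a i)%:~R) ^+ m); split => //.
  have f1 : f^-1 != 0 by rewrite invr_eq0.
  have := steerable_scale f1 r0 st.
  by rewrite scale_scalar_mx mulVf.
by rewrite subrr normr0 ltW.
Qed.

(** The dual of [steerable_diagr]: m and n are exchanged in the bidiagonal family. The duality
    inverts matrices, so the inverses of the x i are approximated. *)
Lemma steerable_diagl m n (x : 'I_m -> R) : (0 < m)%N -> (0 < n)%N ->
  (forall i, 0 < x i) -> steerable (diag_mx (\row_i x i)) (1%:M : 'M[R]_n).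
Proof.
case: m x => // m x _ n0 x0; apply: steerable_lim => e e0.
pose D := diag_mx (\row_i (x i)^-1).
have uD : D \in unitmx.
  rewrite unitmxE det_diag unitfE; apply/prodf_neq0 => i _.
  by rewrite mxE invr_eq0 gt_eqF.
have DE : diag_mx (\row_i x i) = invmx D.
  apply: (can_inj (mulKmx uD)); rewrite mulmxV // mulmx_diag -diag_const_mx.
  by congr diag_mx; apply/rowP => i; rewrite !mxE mulVf // gt_eqF.
have [d d0 hd] := invmx_near uD e0.
have [|a [r [a0 r0 h]]] := @diag_mx_power_approx m n (fun i => (x i)^-1) d n0 d0.
  by move=> i; rewrite invr_gt0.
have [f f0 st] := @asymptotic_ldu_bidiag R n m a a0 n0.
have [ur hr] := hd _ h.
have uf : f%:M \in @unitmx R n by rewrite unitmxE det_scalar unitrX // unitfE.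
have ua : diag_mx (\row_i (a i)%:~R) ^+ n \in @unitmx R m.+1.
  by move: ur; rewrite unitmxZ // unitfE.
have {}st := asymptotic_ldu_steerable (asymptotic_ldu_swap uf ua st).
have r1 : r^-1 != 0 by rewrite invr_eq0.
have {}st := steerable_scale r1 f0 st.
exists (invmx (r *: diag_mx (\row_i (a i)%:~R) ^+ n)), 1%:M; split.
- rewrite invmx_scale //; move: st.
  by rewrite invmx_scalar scale_scalar_mx mulfV.
- by rewrite DE.
- by rewrite subrr normr0 ltW.
Qed.

Lemma rational_approx m n (M : 'M[R]_(m, n)) (e : R) : 0 < e ->
  exists (N : nat) (M1 : 'M[int]_(m, n)),
    (0 < N)%N /\ `|N%:R^-1 *: intv M1 - M| <= e.
Proof.
move=> e0; pose N := (Num.bound e^-1).+1; pose k : R := N%:R.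
have k0 : 0 < k by rewrite ltr0n.
have ke : k^-1 <= e := archi_bound_inv e0.
exists N, (\matrix_(i, j) Num.floor (k * M i j)); split => //.
apply: le_trans ke; apply: mx_norm_le => [|i j]; first by rewrite invr_ge0 ltW.
rewrite !mxE.
have -> : k^-1 * (Num.floor (k * M i j))%:~R - M i j =
    k^-1 * ((Num.floor (k * M i j))%:~R - k * M i j).
  by rewrite mulrBr mulKf // gt_eqF.
rewrite normrM ger0_norm ?invr_ge0 ?(ltW k0) // ler_piMr ?invr_ge0 ?(ltW k0) //.
have := floor_le (k * M i j); have := floorD1_gt (k * M i j).
rewrite intrD ler_norml; set z := (Num.floor _)%:~R; move=> h1 h2.
by apply/andP; split; lra.
Qed.

(* Rational matrices are dense and the Smith normal form makes integer matrices
   diagonal, up to the action of GL(Z) on both sides. *)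
Lemma unitmx_density n (S : 'M[R]_n -> Prop) :
  (forall x : 'I_n -> R, (forall i, 0 < x i) -> S (diag_mx (\row_i x i))) ->
  (forall (L : 'M[int]_n) M, L \in unitmx -> S M -> S (intv L *m M)) ->
  (forall (L : 'M[int]_n) M, L \in unitmx -> S M -> S (M *m intv L)) ->
  (forall (s : R) M, s != 0 -> S M -> S (s *: M)) ->
  (forall M, (forall e : R, 0 < e -> exists2 M', S M' & `|M' - M| <= e) -> S M) ->
  forall M, M \in unitmx -> S M.
Proof.
move=> hdiag hl hr hs hlim M uM; apply: hlim => e e0.
have [d d0 hd] := invmx_near uM e0.
have ed0 : 0 < Num.min e d by rewrite lt_min e0.
have [N [M1 [N0]]] := rational_approx M ed0.
have k0 : N%:R^-1 != 0 :> R by rewrite invr_eq0 pnatr_eq0 -lt0n.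
rewrite le_min => /andP[M1e /hd[u1 _]].
have uM1 : intv M1 \in @unitmx R n by move: u1; rewrite unitmxZ // unitfE.
exists (N%:R^-1 *: intv M1) => //; apply: hs => //.
have [L uL [L' uL' [s _ E]]] := int_Smith_normal_form M1.
(* The signs of the elementary divisors are moved into the unimodular factor L', leaving a positive
   diagonal for [hdiag]. *)
pose sg : 'M[int]_n := diag_mx (\row_i sgz s`_i).
pose ab : 'M[R]_n := diag_mx (\row_i (`|s`_i|%:~R : R)).
have E' : intv M1 = intv L *m ab *m intv (sg *m L').
  have -> : ab = intv (diag_mx (\row_(i < n) `|s`_i|)).
    by apply/matrixP => i j; rewrite !mxE rmorphMn.
  rewrite E -!map_mxM /= !mulmxA; congr (intv (_ *m _)).
  rewrite -mulmxA mulmx_diag; congr (_ *m _); apply/matrixP => i j.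
  by rewrite !mxE mulrC -intEsg.
have s0 (i : 'I_n) : s`_i != 0.
  move: uM1; rewrite E' !unitmx_mul => /andP[/andP[_ uab] _].
  move: uab; rewrite unitmxE det_diag unitfE => /prodf_neq0/(_ i isT).
  by rewrite mxE intr_eq0 normr_eq0.
rewrite E'; apply: hr; last apply: hl => //; last apply: hdiag => i.
- rewrite unitmx_mul uL' andbT unitmxE det_diag.
  apply: rpred_prod => i _; rewrite mxE.
  move: (s`_i) (s0 i) => z; case: (ltrgtP z 0) => // h _.
    by rewrite ltr0_sgz // unitrN1.
  by rewrite gtr0_sgz // unitr1.
- by rewrite ltr0z normr_gt0 s0.
Qed.

(** (B, C) is the product of (1, C) and (B, 1); in each factor the steerable matrices satisfy the
    closure properties of [unitmx_density]. *)
Lemma steerable_unit m n (B : 'M[R]_m) (C : 'M[R]_n) : (0 < m)%N -> (0 < n)%N ->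
  B \in unitmx -> C \in unitmx -> steerable B C.
Proof.
move=> m0 n0 uB uC; rewrite -[B]mulmx1 -[C]mul1mx; apply: steerable_mul.
- move: C uC; apply: unitmx_density => [x x0|L M uL h|L M uL h|s M s0 h|M h].
  + exact: steerable_diagr.
  + by have := steerable_intl (unitmx1 _ m) uL h; rewrite map_mx1 mul1mx.
  + by have := steerable_intr (unitmx1 _ m) uL h; rewrite map_mx1 mulmx1.
  + by have := steerable_scale (oner_neq0 R) s0 h; rewrite scale1r.
  + apply: steerable_lim => e e0; have [M' h1 h2] := h _ e0.
    by exists 1%:M, M'; split => //; rewrite subrr normr0 ltW.
- move: B uB; apply: unitmx_density => [x x0|L M uL h|L M uL h|s M s0 h|M h].
  + exact: steerable_diagl.
  + by have := steerable_intl uL (unitmx1 _ n) h; rewrite map_mx1 mul1mx.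
  + by have := steerable_intr uL (unitmx1 _ n) h; rewrite map_mx1 mulmx1.
  + by have := steerable_scale s0 (oner_neq0 R) h; rewrite scale1r.
  + apply: steerable_lim => e e0; have [M' h1 h2] := h _ e0.
    by exists M', 1%:M; split => //; rewrite subrr normr0 ltW.
Qed.

(* The Smith normal form of the column (N; M) yields a coprime factorisation
   N^-1 M = be de^-1, hence a W whose Moebius map sends 0 to N^-1 M. *)
Lemma moebius_rational_target m n (N : nat) (M : 'M[int]_(m, n)) : (0 < N)%N ->
  let A0 : 'M[R]_(m, n) := N%:R^-1 *: intv M in
  exists b0 c0, [/\ b0 \in unitmx, c0 \in unitmx & forall e : R, 0 < e ->
    exists2 d : R, 0 < d & forall A1 : 'M[R]_(m, n), `|A1| <= d ->
    exists A2 b c g, reach A1 A2 b c g /\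
      [/\ `|A2 - A0| <= e, `|b - b0| <= e & `|c - c0| <= e]].
Proof.
move=> N0 A0; have k0 : N%:R != 0 :> R by rewrite pnatr_eq0 -lt0n.
have [L uL [L' uL' [s _ E]]] := int_Smith_normal_form (col_mx (N%:Z%:M) M).
pose al : 'M[R]_m := intv (drsubmx L); pose be : 'M[R]_(m, n) := intv (dlsubmx L).
pose ga : 'M[R]_(n, m) := intv (ursubmx L); pose de : 'M[R]_n := intv (ulsubmx L).
have uW : swap_mx L \in unitmx.
  have : swap_mx L *m swap_mx (invmx L) = 1%:M by rewrite -swap_mx_mul mulmxV // swap_mx1.
  by move=> /mulmx1_unit[].
have WE : intv (swap_mx L) = block_mx al be ga de by rewrite map_block_mx.
pose D1 : 'M[int]_n := \matrix_(i, j) (s`_i *+ (i == j :> nat)).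
have DE : \matrix_(i, j) (s`_i *+ (i == j :> nat)) = col_mx D1 0 :> 'M[int]_(n + m, n).
  apply/matrixP => i j; case: (split_ordP i) => i' ->.
    by rewrite col_mxEu !mxE.
  rewrite col_mxEd !mxE /=.
  by rewrite gtn_eqF // (leq_trans (ltn_ord j)) // leq_addr.
(* K is a common right factor: N = de K and M = be K, whence N^-1 M = be de^-1. *)
pose K : 'M[R]_n := intv (D1 *m L').
have [deK beK] : de *m K = N%:R%:M /\ be *m K = intv M.
  move: E; rewrite DE -mulmxA mul_col_mx mul0mx -{1}[L]submxK mul_block_col !mulmx0 !addr0.
  move=> /eq_col_mx[E1 E2]; rewrite -!map_mxM /= -E1 -E2; split => //.
  by rewrite map_scalar_mx.
have [ude uK] : de \in unitmx /\ K \in unitmx.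
  have : de *m (N%:R^-1 *: K) = 1%:M by rewrite -scalemxAr deK scale_scalar_mx mulVf.
  by move=> /mulmx1_unit[-> ]; rewrite unitmxZ ?unitfE ?invr_eq0.
have beE : be = A0 *m de.
  apply: (can_inj (mulmxK uK)); rewrite beK -mulmxA deK mul_mx_scalar /A0.
  by rewrite scalerA mulfV // scale1r.
(* b0 and de are the values of b and c when the Moebius map is applied at 0; the rest is continuity
   there. *)
pose b0 := al - A0 *m ga.
have ub0 : b0 \in unitmx.
  have := @reach_moebius _ _ _ _ _ _ _ _ 0 uW WE.
  by rewrite !mulmx0 !add0r beE mulmxK // => /(_ ude)[].
exists b0, de; split => // e e0.
have [d1 d10 hd1] := mx_norm_mul_near (0 : 'M[R]_(m, n)) ga e0.
have e10 : 0 < Num.min e d1 by rewrite lt_min e0.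
have [d2 d20 hd2] := mx_norm_mul_near b0 (0 : 'M[R]_(m, n)) e10.
have [d3 d30 hd3] := mx_norm_mul_near (0 : 'M[R]_(m, n)) (invmx de) d20.
have [d4 d40 hd4] := invmx_near ude d30.
have e40 : 0 < Num.min e d4 by rewrite lt_min e0.
have [d5 d50 hd5] := mx_norm_mul_near ga (0 : 'M[R]_(m, n)) e40.
exists (Num.min d3 d5); first by rewrite lt_min d30.
move=> A1; rewrite le_min => /andP[A13 A15].
have cde : `|ga *m A1 + de - de| <= Num.min e d4.
  rewrite addrK; have := hd5 ga A1; rewrite subrr normr0 mulmx0 !subr0; apply => //.
  exact: ltW.
move: cde; rewrite le_min => /andP[ce c4].
have [uc hc] := hd4 _ c4; have r := reach_moebius uW WE uc.
set c := ga *m A1 + de in ce c4 uc hc r; set A2 := _ *m invmx c in r.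
have A2E : A2 - A0 = b0 *m (A1 *m invmx c).
  apply: (can_inj (mulmxK uc)); rewrite mulmxBl mulmxKV // -mulmxA mulmxKV //.
  rewrite beE /c /b0 mulmxBl mulmxDr mulmxA opprD addrACA subrr addr0 //.
have : `|A2 - A0| <= Num.min e d1.
  rewrite A2E; have := hd2 b0 (A1 *m invmx c).
  rewrite subrr normr0 mulmx0 !subr0; apply; first exact: ltW.
  by have := hd3 A1 (invmx c); rewrite mul0mx !subr0; apply.
rewrite le_min => /andP[A2e A21].
exists A2, (al - A2 *m ga), c, ga; split => //; split => //.
have -> : al - A2 *m ga - b0 = - ((A2 - A0) *m ga).
  by rewrite /b0 mulmxBl !opprB addrC subrKA.
rewrite normrN; have := hd1 (A2 - A0) ga.
by rewrite mul0mx !subr0 subrr normr0; apply => //; exact: ltW.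
Qed.

(** Steer close to 0, then apply one fixed Moebius map that sends 0 near A0. Its factors b0 and c0
    are compensated in advance by aiming at b0^-1 B and c0^-1 C. *)
Lemma steer_near m n (A A0 : 'M[R]_(m, n)) (B : 'M[R]_m) (C : 'M[R]_n) (e : R) :
  (0 < m)%N -> (0 < n)%N -> B \in unitmx -> C \in unitmx -> 0 < e ->
  exists A' b c g (s t : R), [/\ reach A A' b c g, s != 0 & t != 0] /\
    [/\ `|A' - A0| <= e, `|s *: b - B| <= e & `|t *: c - C| <= e].
Proof.
move=> m0 n0 uB uC e0; have e20 : 0 < e / 2 by rewrite divr_gt0.
have [N [M [N0 hM]]] := rational_approx A0 e20.
have [b0 [c0 [ub0 uc0 h]]] := moebius_rational_target M N0.
pose B1 := invmx b0 *m B; pose C1 := invmx c0 *m C.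
have st : steerable B1 C1 by apply: steerable_unit; rewrite // unitmx_mul unitmx_inv ?ub0 ?uc0.
have [d1 d10 hd1] := mx_norm_mul_near b0 B1 e0.
have [d2 d20 hd2] := mx_norm_mul_near c0 C1 e0.
have f0 : 0 < Num.min (e / 2) (Num.min d1 d2) by rewrite !lt_min e20 d10.
have [d d0 {}h] := h _ f0.
have f10 : 0 < Num.min d (Num.min d1 d2) by rewrite !lt_min d0 d10.
have [A1 [b [c [g [s [t [[r s0 t0] [hA hb hc]]]]]]]] := st A _ f10.
move: hA hb hc; rewrite !le_min => /andP[Ad _] /and3P[_ b1 _] /and3P[_ _ c2].
have [A2 [b' [c' [g' [r' []]]]]] := h A1 Ad.
rewrite !le_min => /andP[A2e _] /and3P[_ b'1 _] /and3P[_ _ c'2].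
exists A2, (b' *m b), (c' *m c), (c' *m g + g' *m b), s, t; split; split => //.
- exact: reach_trans r r'.
- by rewrite -(subrKA (N%:R^-1 *: intv M)) (le_trans (ler_normD _ _)) // [leRHS]splitr lerD.
- by rewrite scalemxAr -[B](mulKVmx ub0); exact: hd1.
- by rewrite scalemxAr -[C](mulKVmx uc0); exact: hd2.
Qed.

End Density.

(** * Contractions and intermediate values *)

Section Contraction.
Variable R : realType.

(* If u i0 = 1, multiplies u by th and fixes the vectors whose i0-th entry is 0. *)
Definition contract_mx k (u : 'cV[R]_k) (i0 : 'I_k) (th : R) : 'M[R]_k :=
  \matrix_(i, j) ((i == j)%:R - (1 - th) * u i ord0 * (j == i0)%:R).

Lemma contract_mxE k (u : 'cV[R]_k) i0 th (x : 'cV[R]_k) :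
  contract_mx u i0 th *m x = x - ((1 - th) * x i0 ord0) *: u.
Proof.
apply/matrixP => i j; rewrite (ord1 j) !mxE.
under eq_bigr do rewrite mxE mulrBl.
rewrite sumrB (bigD1 i) //= eqxx mul1r big1 ?addr0 => [|l /negbTE li]; last first.
  by rewrite eq_sym li mul0r.
rewrite (bigD1 i0) //= eqxx mulr1 big1 ?addr0 => [|l /negbTE ->]; last first.
  by rewrite mulr0 mul0r.
by congr (_ - _); ring.
Qed.

Lemma contract_mx1 k (u : 'cV[R]_k) i0 : contract_mx u i0 1 = 1%:M.
Proof. by apply/matrixP => i j; rewrite !mxE subrr !mul0r subr0. Qed.

Lemma det_contract_mx k (u : 'cV[R]_k) i0 th : u i0 ord0 = 1 ->
  \det (contract_mx u i0 th) = th.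
Proof.
move=> u1; rewrite (expand_det_row _ i0) (bigD1 i0) //= big1 ?addr0; last first.
  move=> j /negbTE ji; rewrite mxE eq_sym ji mulr0 subr0 mul0r //.
rewrite mxE eqxx u1 !mulr1 opprB addrC subrK /cofactor addnn -signr_odd odd_double expr0 mul1r.
have -> : row' i0 (col' i0 (contract_mx u i0 th)) = 1%:M.
  apply/matrixP => i j; rewrite !mxE (inj_eq lift_inj).
  by rewrite [lift i0 j == i0]eq_sym (negbTE (neq_lift _ _)) mulr0 subr0.
by rewrite det1 mulr1.
Qed.

Lemma contract_mx_unit k (u : 'cV[R]_k) i0 th : u i0 ord0 = 1 -> th != 0 ->
  contract_mx u i0 th \in unitmx.
Proof. by move=> u1 th0; rewrite unitmxE det_contract_mx // unitfE. Qed.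

Lemma contract_mx_lip k (u : 'cV[R]_k) i0 th th' :
  `|contract_mx u i0 th' - contract_mx u i0 th| <= `|th' - th| * `|u|.
Proof.
apply: mx_norm_le => [|i j]; first by rewrite mulr_ge0.
rewrite !mxE.
have -> : (i == j)%:R - (1 - th') * u i ord0 * (j == i0)%:R -
    ((i == j)%:R - (1 - th) * u i ord0 * (j == i0)%:R) =
    (th' - th) * (u i ord0 * (j == i0)%:R) by ring.
rewrite normrM ler_wpM2l // normrM normr_nat.
rewrite -[leRHS]mulr1 ler_pM ?mx_entry_le //.
by rewrite lern1 leq_b1.
Qed.

(** The image of x is th x + (1 - th) (x - x_i0 u), and both terms are O(th |x|). K depends on N
    alone: u is to be found after th is fixed. *)
Lemma contract_mx_norm k (N : 'cV[R]_k -> R) : is_norm N ->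
  exists2 K : R, 0 <= K & forall (u : 'cV[R]_k) i0 th (x : 'cV[R]_k), 0 <= th -> th <= 1 ->
    `|x - x i0 ord0 *: u| <= th * `|x| -> N (contract_mx u i0 th *m x) <= th * K * N x.
Proof.
move=> HN; have [c c0 hc] := is_norm_ge HN; have [C C0 hC] := is_norm_le HN.
exists (2 * C / c) => [|u i0 th x th0 th1 h].
  by rewrite divr_ge0 ?mulr_ge0 // ltW.
have -> : contract_mx u i0 th *m x = th *: x + (1 - th) *: (x - x i0 ord0 *: u).
  by rewrite contract_mxE scalerBr scalerA addrA -scalerDl [th + _]addrC subrK scale1r.
rewrite (le_trans (hC _)) //.
have n1 : `|th *: x + (1 - th) *: (x - x i0 ord0 *: u)| <= 2 * th * `|x|.
  rewrite (le_trans (ler_normD _ _)) // !normrZ (ger0_norm th0).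
  rewrite (@ger0_norm _ (1 - th)) ?subr_ge0 //.
  have : (1 - th) * `|x - x i0 ord0 *: u| <= 1 * (th * `|x|).
    by rewrite ler_pM ?subr_ge0 // gerBl.
  by lra.
apply: (@le_trans _ _ (C * (2 * th * `|x|))); first by rewrite ler_wpM2l.
have -> : th * (2 * C / c) * N x = C * (2 * th * (N x / c)) by field; rewrite gt_eqF.
rewrite ler_wpM2l // ler_wpM2l ?mulr_ge0 // ler_pdivlMr // mulrC.
exact: hc.
Qed.

(* Pigeonhole on the directions of the x_M, rounded to a finite grid. *)
Lemma recurrent_direction k (x : nat -> 'cV[R]_k) (d : R) : (0 < k)%N -> 0 < d ->
  exists i0 (u : 'cV[R]_k), u i0 ord0 = 1 /\ forall N, exists2 M, (N <= M)%N &
    `|x M - x M i0 ord0 *: u| <= d * `|x M|.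
Proof.
move=> k0 d0.
pose N := (Num.bound d^-1).+1; pose n : R := N%:R.
have n0 : 0 < n by rewrite ltr0n.
have nd : n^-1 <= d := archi_bound_inv d0.
have /choice[im him] M : exists i, `|x M| = `|x M i ord0|.
  have [h|/mx_norm_neq0[[i j] /= h]] := eqVneq (mx_norm (x M)) 0.
    exists (Ordinal k0); rewrite -[LHS]/(mx_norm (x M)) h.
    by rewrite (mx_norm_eq0 h) mxE normr0.
  by exists i; rewrite -[LHS]/(mx_norm (x M)) h (ord1 j).
(* When x M = 0 the quotient is 0 by convention, and [rtE] and [rt1] still hold. *)
pose rt M j := x M j ord0 / x M (im M) ord0.
have rtE M j : x M j ord0 = x M (im M) ord0 * rt M j.
  have [h|h] := eqVneq (x M (im M) ord0) 0; last by rewrite /rt mulrC divfK.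
  rewrite h mul0r; apply/eqP; rewrite -normr_le0.
  by have := mx_entry_le (x M) j ord0; rewrite him h normr0.
have rt1 M j : `|rt M j| <= 1.
  rewrite /rt normrM normfV -him.
  have [h|h] := eqVneq `|x M| 0; first by rewrite h invr0 mulr0.
  by rewrite ler_pdivrMr ?mul1r ?mx_entry_le // lt_neqAle eq_sym h normr_ge0.
pose T := ('I_k * {ffun 'I_k -> 'I_(2 * N).+1})%type.
pose gr M j : nat := absz (Num.floor (n * (rt M j + 1))).
have gr_le M j : (gr M j < (2 * N).+1)%N.
  have := rt1 M j; rewrite ler_norml => /andP[r1 r2].
  have h0 : 0 <= n * (rt M j + 1) by rewrite mulr_ge0 ?(ltW n0) //; lra.
  have z0 : 0 <= Num.floor (n * (rt M j + 1)) by rewrite floor_ge0.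
  have : Num.floor (n * (rt M j + 1)) <= (2 * N)%:Z.
    rewrite -(ler_int R) (le_trans (floor_le _)) // -pmulrn natrM mulrC ler_wpM2r ?(ltW n0) //.
    by lra.
  by rewrite /gr; move: (Num.floor _) z0 => z z0; lia.
pose tag M : T := (im M, [ffun j => Ordinal (gr_le M j)]).
have [t ht] : exists t, forall N, exists2 M, (N <= M)%N & tag M = t.
  apply: contrapT => h.
  have /choice[f hf] t : exists N0, forall M, (N0 <= M)%N -> tag M <> t.
    apply: contrapT => h1; apply: h; exists t => N0; apply: contrapT => h2.
    by apply: h1; exists N0 => M NM tM; apply: h2; exists M.
  have [M hM] : exists M, forall t, (f t <= M)%N.
    by exists (\max_t f t) => t; exact: leq_bigmax.
  exact: (hf (tag M) M (hM _)).
(* The corner of the recurrent grid cell, with the dominant coordinate set to exactly 1. *)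
pose u : 'cV[R]_k := \col_j (if j == t.1 then 1 else (t.2 j : nat)%:R / n - 1).
exists t.1, u; split; first by rewrite mxE eqxx.
move=> N1; have [M NM tM] := ht N1; exists M => //.
apply: mx_norm_le => [|i j]; first by rewrite mulr_ge0 // ltW.
rewrite (ord1 j) !mxE -tM /=; have [->|_] := eqVneq i (im M).
  by rewrite mulr1 subrr normr0 mulr_ge0 // ltW.
rewrite ffunE /= (rtE M i) -mulrBr normrM -him mulrC ler_wpM2r //.
apply: le_trans nd; rewrite /gr.
have := rt1 M i; rewrite ler_norml => /andP[r1 r2].
have h0 : 0 <= n * (rt M i + 1) by rewrite mulr_ge0 ?(ltW n0) //; lra.
have z0 : 0 <= Num.floor (n * (rt M i + 1)) by rewrite floor_ge0.
have -> : (absz (Num.floor (n * (rt M i + 1))))%:R = (Num.floor (n * (rt M i + 1)))%:~R :> R.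
  by rewrite -{2}(gez0_abs z0) pmulrn.
have := floor_le (n * (rt M i + 1)); have := floorD1_gt (n * (rt M i + 1)).
rewrite intrD; set z : R := (Num.floor _)%:~R => g1 g2.
have -> : rt M i - (z / n - 1) = (n * (rt M i + 1) - z) / n by field; rewrite gt_eqF.
rewrite normrM [X in _ * X]ger0_norm ?invr_ge0 ?(ltW n0) //.
rewrite ler_piMl ?invr_ge0 ?(ltW n0) // ler_norml; apply/andP; split; lra.
Qed.

End Contraction.

(** * Values taken by the normalised Lagrange constant *)

Section Values.
Variable R : realType.
Variables (m n : nat) (m0 : (0 < m)%N) (n0 : (0 < n)%N).
Variables (rho : 'cV[R]_m -> R) (sigma : 'cV[R]_n -> R).
Hypotheses (Hrho : is_norm rho) (Hsigma : is_norm sigma).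
Variable A : 'M[R]_(m, n).

Let ratio := lagrange_ratio A rho sigma.

Let good_sequence : exists xq : nat -> 'cV[R]_m * 'cV[R]_n,
  forall M, [/\ lat A (xq M).1 (xq M).2, M%:R <= `|(xq M).2| &
    sigma (xq M).2 ^+ n * rho (xq M).1 ^+ m < lagrange_constant rho sigma A + 1].
Proof.
suff /choice[xq hxq] (M : nat) : exists xq : 'cV[R]_m * 'cV[R]_n,
    [/\ lat A xq.1 xq.2, M%:R <= `|xq.2| &
    sigma xq.2 ^+ n * rho xq.1 ^+ m < lagrange_constant rho sigma A + 1].
  by exists xq.
have l1 : lagrange_constant rho sigma A < lagrange_constant rho sigma A + 1.
  by rewrite ltrDl.
have [x [q [h1 h2 h3]]] := lagrange_constant_lt m0 n0 Hrho Hsigma M%:R l1.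
by exists (x, q).
Qed.

(** The left side is th^(p-1) K^p r, which tends to 0 with th because p > 1. *)
Let small_factor (p : nat) (K r e : R) : (1 < p)%N -> 0 <= K -> 0 <= r -> 0 < e ->
  exists2 th : R, 0 < th <= 1 & (th * K) ^+ p * r / th <= e.
Proof.
move=> p1 K0 r0 e0; have c0 : 0 < K ^+ p * r + 1.
  by rewrite ltr_wpDl // mulr_ge0 // exprn_ge0.
pose th := Num.min 1 (e / (K ^+ p * r + 1)).
have th0 : 0 < th by rewrite lt_min ltr01 divr_gt0.
have th1 : th <= 1 by rewrite ge_min lexx.
exists th; first by rewrite th0.
case: p p1 c0 @th th0 th1 => [//|p] p1 c0 th th0 th1.
have -> : (th * K) ^+ p.+1 * r / th = th ^+ p * (K ^+ p.+1 * r).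
  by rewrite exprMn [th ^+ p.+1]exprS; field; rewrite gt_eqF.
apply: (@le_trans _ _ (th * (K ^+ p.+1 * r + 1))); last first.
  by rewrite -ler_pdivlMr // ge_min lexx orbT.
rewrite ler_pM ?exprn_ge0 ?(ltW th0) ?mulr_ge0 ?exprn_ge0 ?lerDl //.
rewrite -[leRHS]expr1; apply: ler_wiXn2l => //; exact: ltW.
Qed.

(** Along infinitely many good approximations x is nearly parallel to u, so rho of its contraction
    is at most th K rho x. This gains (th K)^m against the determinant th. *)
Lemma lagrange_ratio_contract_l (e : R) : (1 < m)%N -> 0 < e ->
  exists i0 (u : 'cV[R]_m) (th : R), [/\ u i0 ord0 = 1, 0 < th <= 1 &
    ratio (contract_mx u i0 th) 1%:M <= e].
Proof.
move=> m1 e0; have [xq hxq] := good_sequence; set l := lagrange_constant _ _ _ in hxq.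
have l0 : 0 <= l by exact: lagrange_constant_ge0.
have [K K0 hK] := contract_mx_norm Hrho.
have [|th th01 hth] := @small_factor m K (l + 1) e m1 K0 _ e0; first exact: addr_ge0.
have [th0 th1] := andP th01.
have [i0 [u [u1 hu]]] := recurrent_direction (fun M => (xq M).1) m0 th0.
exists i0, u, th; split => //; apply: le_trans hth.
rewrite /ratio /lagrange_ratio det_contract_mx // det1 mulr1 (gtr0_norm th0).
have uB := contract_mx_unit u1 (lt0r_neq0 th0).
rewrite ler_wpM2r ?invr_ge0 ?(ltW th0) //.
apply: (lagrange_constant_le m0 n0 (is_norm_unit uB Hrho)
  (is_norm_unit (unitmx1 R n) Hsigma)) => X.
have [M NM dM] := hu (Num.bound `|X|).+1.
have [h1 h2 h3] := hxq M; exists (xq M).1, (xq M).2; split => //.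
  rewrite (le_trans _ h2) // (le_trans (ler_norm X)) //.
  rewrite (le_trans (ltW (archi_boundP (normr_ge0 X)))) // ler_nat.
  exact: leq_trans (leqnSn _) NM.
rewrite /= mul1mx.
have k1 := hK u i0 th (xq M).1 (ltW th0) th1 dM.
apply: (@le_trans _ _ (sigma (xq M).2 ^+ n * (th * K * rho (xq M).1) ^+ m)).
  rewrite ler_wpM2l ?exprn_ge0 ?(is_norm_ge0 _ Hsigma) //.
  rewrite lerXn2r ?nnegrE ?(is_norm_ge0 _ Hrho) //.
  by rewrite !mulr_ge0 ?(is_norm_ge0 _ Hrho) ?(ltW th0).
rewrite [(th * K * _) ^+ m]exprMn mulrCA ler_wpM2l ?(ltW h3) //.
by rewrite exprn_ge0 // mulr_ge0 // ltW.
Qed.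

Lemma lagrange_ratio_contract_r (e : R) : (1 < n)%N -> 0 < e ->
  exists i0 (u : 'cV[R]_n) (th : R), [/\ u i0 ord0 = 1, 0 < th <= 1 &
    ratio 1%:M (contract_mx u i0 th) <= e].
Proof.
move=> n1 e0; have [xq hxq] := good_sequence; set l := lagrange_constant _ _ _ in hxq.
have l0 : 0 <= l by exact: lagrange_constant_ge0.
have [K K0 hK] := contract_mx_norm Hsigma.
have [|th th01 hth] := @small_factor n K (l + 1) e n1 K0 _ e0; first exact: addr_ge0.
have [th0 th1] := andP th01.
have [i0 [u [u1 hu]]] := recurrent_direction (fun M => (xq M).2) n0 th0.
exists i0, u, th; split => //; apply: le_trans hth.
rewrite /ratio /lagrange_ratio det_contract_mx // det1 mul1r (gtr0_norm th0).
have uB := contract_mx_unit u1 (lt0r_neq0 th0).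
rewrite ler_wpM2r ?invr_ge0 ?(ltW th0) //.
apply: (lagrange_constant_le m0 n0 (is_norm_unit (unitmx1 R m) Hrho)
  (is_norm_unit uB Hsigma)) => X.
have [M NM dM] := hu (Num.bound `|X|).+1.
have [h1 h2 h3] := hxq M; exists (xq M).1, (xq M).2; split => //.
  rewrite (le_trans _ h2) // (le_trans (ler_norm X)) //.
  rewrite (le_trans (ltW (archi_boundP (normr_ge0 X)))) // ler_nat.
  exact: leq_trans (leqnSn _) NM.
rewrite /= mul1mx.
have k1 := hK u i0 th (xq M).2 (ltW th0) th1 dM.
apply: (@le_trans _ _ ((th * K * sigma (xq M).2) ^+ n * rho (xq M).1 ^+ m)).
  rewrite ler_wpM2r ?exprn_ge0 ?(is_norm_ge0 _ Hrho) //.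
  rewrite lerXn2r ?nnegrE ?(is_norm_ge0 _ Hsigma) //.
  by rewrite !mulr_ge0 ?(is_norm_ge0 _ Hsigma) ?(ltW th0).
rewrite [(th * K * _) ^+ n]exprMn -mulrA ler_wpM2l ?(ltW h3) //.
by rewrite exprn_ge0 // mulr_ge0 // ltW.
Qed.

Let ivt_ratio (B : R -> 'M[R]_m) (C : R -> 'M[R]_n) (L th t : R) :
  0 < th <= 1 ->
  (forall s, 0 < s -> B s \in unitmx /\ C s \in unitmx) ->
  (forall s s', `|B s' - B s| <= `|s' - s| * L) ->
  (forall s s', `|C s' - C s| <= `|s' - s| * L) ->
  ratio (B th) (C th) <= t <= ratio (B 1) (C 1) ->
  exists2 s : R, 0 < s & ratio (B s) (C s) = t.
Proof.
move=> /andP[th0 th1] hu hB hC /andP[t1 t2].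
have L0 : 0 <= L.
  have := le_trans (normr_ge0 _) (hB 0 1); rewrite subr0 normr1 mul1r //.
pose f s := ratio (B s) (C s).
have fc : {within `[th, 1], continuous f}.
  apply: continuous_in_subspaceT => s; rewrite inE /= in_itv /= => /andP[ths _].
  have s0 : 0 < s by exact: lt_le_trans ths.
  have [uB uC] := hu _ s0.
  apply/cvgrPdist_le => e e0.
  have [d d0 hd] := lagrange_ratio_near m0 n0 A Hrho Hsigma uB uC e0.
  apply/nbhs_ballP; exists (d / (L + 1)) => /=; first by rewrite divr_gt0 // ltr_wpDl.
  move=> s' /= ss'.
  have sL : `|s' - s| * L <= d.
    rewrite distrC; apply: (@le_trans _ _ (`|s - s'| * (L + 1))).
      by rewrite ler_wpM2l // lerDl.
    by rewrite -ler_pdivlMr ?ltr_wpDl // ltW.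
  have [||_ _ h] := hd (B s') (C s').
  - exact: le_trans (hB _ _) sL.
  - exact: le_trans (hC _ _) sL.
  - by rewrite distrC.
have [|s] := @IVT R f th 1 t th1 fc.
  by rewrite ge_min le_max /f t1 t2 orbT.
rewrite in_itv /= => /andP[ths _] fs; exists s => //; exact: lt_le_trans ths.
Qed.

Lemma lagrange_ratio_value (t : R) : (1 < maxn m n)%N ->
  0 < t -> t <= lagrange_constant rho sigma A ->
  exists B C, [/\ B \in unitmx, C \in unitmx & ratio B C = t].
Proof.
move=> mn t0 tl; have [m1|m1] := leqP m 1; last first.
- have [i0 [u [th [u1 th01 h]]]] := lagrange_ratio_contract_l m1 t0.
  have [|s s'|s s'||s s0 st] := @ivt_ratio (contract_mx u i0) (fun=> 1%:M) `|u| th t th01.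
  + by move=> s s0; rewrite contract_mx_unit ?gt_eqF // unitmx1.
  + exact: contract_mx_lip.
  + by rewrite subrr normr0 mulr_ge0.
  + by rewrite contract_mx1 /ratio lagrange_ratio1 h.
  by exists (contract_mx u i0 s), 1%:M; rewrite contract_mx_unit ?gt_eqF // unitmx1.
- have n1 : (1 < n)%N by move: mn; rewrite /maxn; case: ifP => // _; rewrite ltnNge m1.
  have [i0 [u [th [u1 th01 h]]]] := lagrange_ratio_contract_r n1 t0.
  have [|s s'|s s'||s s0 st] := @ivt_ratio (fun=> 1%:M) (contract_mx u i0) `|u| th t th01.
  + by move=> s s0; rewrite contract_mx_unit ?gt_eqF // unitmx1.
  + by rewrite subrr normr0 mulr_ge0.
  + exact: contract_mx_lip.
  + by rewrite contract_mx1 /ratio lagrange_ratio1 h.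
  by exists 1%:M, (contract_mx u i0 s); rewrite contract_mx_unit ?gt_eqF // unitmx1.
Qed.

End Values.

Lemma lagrange_constant_approx (R : realType) (m n : nat)
    (rho : 'cV[R]_m -> R) (sigma : 'cV[R]_n -> R) (A0 : 'M[R]_(m, n)) (t e : R) :
  (0 < m)%N -> (0 < n)%N -> (1 < maxn m n)%N -> is_norm rho -> is_norm sigma ->
  0 < t -> t < lagrange_sup rho sigma -> 0 < e ->
  exists A, `|A - A0| <= e /\ `|lagrange_constant rho sigma A - t| <= e.
Proof.
move=> m0 n0 mn Hrho Hsigma t0 tL e0.
have [S0 _] := has_sup_lagrange_spectrum m0 n0 Hrho Hsigma.
have [_ [A1 _ <-] tA1] := sup_gt S0 tL.
have [B [C [uB uC BC]]] := lagrange_ratio_value m0 n0 Hrho Hsigma mn t0 (ltW tA1).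
have [d d0 hd] := lagrange_ratio_near m0 n0 A1 Hrho Hsigma uB uC e0.
have f0 : 0 < Num.min e d by rewrite lt_min e0.
have [A [b [c [g [s [t' [[r s0 t0'] []]]]]]]] := steer_near A1 A0 m0 n0 uB uC f0.
rewrite !le_min => /andP[Ae _] /andP[_ bd] /andP[_ cd].
exists A; split => //; rewrite (reach_lagrange_ratio m0 n0 Hrho Hsigma r).
have [ub uc _ _] := r.
by rewrite -(lagrange_ratio_scale m0 n0 A1 Hrho Hsigma ub uc s0 t0') -BC; have [] := hd _ _ bd cd.
Qed.

Theorem theorem1p1 (R : realType) (m n : nat) (hm : (0 < m)%N) (hn : (0 < n)%N)
    (hmn : (1 < maxn m n)%N)
    (rho : 'cV[R]_m -> R) (sigma : 'cV[R]_n -> R)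
    (hrho : is_norm rho) (hsigma : is_norm sigma) :
  closure (lagrange_spectrum rho sigma) = `[0, lagrange_sup rho sigma]%classic
  /\ forall a b : R, a < b ->
       `]a, b[%classic `<=` `[0, lagrange_sup rho sigma]%classic ->
       dense [set A : 'M[R]_(m, n) |
                lagrange_constant rho sigma A \in `]a, b[].
Proof.
have approx := lagrange_constant_approx _ hm hn hmn hrho hsigma.
split.
  have [S0 Sub] := has_sup_lagrange_spectrum hm hn hrho hsigma.
  rewrite eqEsubset; split.
    rewrite closureE; apply: smallest_sub; first exact: interval_closed.
    move=> _ [A _ <-] /=; rewrite in_itv /= lagrange_constant_ge0 //=.
    by apply: ub_le_sup => //; exists A.
  move=> t /=; rewrite in_itv /= => /andP[t0 tL]; set L := lagrange_sup _ _ in tL approx.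
  (* If L <= 0, the interval contains nothing but 0, the Lagrange constant of the zero matrix. *)
  have [L0|L0] := leP L 0.
    have -> : t = lagrange_constant rho sigma 0.
      apply/eqP; rewrite eq_le (le_trans tL (le_trans L0 _)) ?lagrange_constant_ge0 //=.
      rewrite (le_trans _ t0) // (le_trans _ L0) //.
      by apply: ub_le_sup => //; exists 0.
    by apply: subset_closure; exists 0.
  move=> U /nbhs_ballP[e /= e0 he].
  pose s := Num.min 2^-1 (e / (4 * L)).
  have s0 : 0 < s by rewrite lt_min invr_gt0 ltr0n divr_gt0 // mulr_gt0.
  have s2 : s <= 2^-1 by rewrite ge_min lexx.
  have sL : s * L <= e / 4.
    rewrite -ler_pdivlMr // -mulrA -invfM ge_min lexx orbT //.
  (* Moving t slightly towards L / 2 puts it strictly between 0 and L, as [lagrange_constant_approx]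
     requires; the factor s keeps the shift within e / 4. *)
  pose t' := t + s * (L / 2 - t).
  have st : s * t <= s * L by rewrite ler_wpM2l // ltW.
  have st0 : 0 <= s * t by rewrite mulr_ge0 // ltW.
  have sL0 : 0 < s * L by rewrite mulr_gt0.
  have t'E : t' = t + s * L / 2 - s * t by rewrite /t'; ring.
  have stt : s * t <= 2^-1 * t by rewrite ler_wpM2r.
  have sLt : s * (L - t) <= 2^-1 * (L - t) by rewrite ler_wpM2r // subr_ge0.
  have t'0 : 0 < t' by lra.
  have t'L : t' < L by lra.
  have [A [_ hA]] := approx 0 t' (e / 4) t'0 t'L (divr_gt0 e0 (ltr0n _ 4)).
  exists (lagrange_constant rho sigma A); split; first by exists A.
  apply: he; rewrite -ball_normE /=.
  rewrite -(subrKA t') (le_lt_trans (ler_normD _ _)) //.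
  have : `|t - t'| <= e / 4.
    by rewrite t'E ler_norml; apply/andP; split; lra.
  by rewrite [`|t' - _|]distrC; lra.
move=> a b ab sub U [A0 UA0] oU.
pose t := (a + b) / 2.
have inside x : a < x -> x < b -> 0 <= x <= lagrange_sup rho sigma.
  by move=> ax xb; have := sub x; rewrite /= !in_itv /= ax xb => /(_ isT).
(* Two points of the interval on either side of its midpoint t, to get the strict inequalities 0 < t
   < L. *)
have /andP[h1 _] : 0 <= (3 * a + b) / 4 <= lagrange_sup rho sigma by apply: inside; lra.
have /andP[_ h2] : 0 <= (a + 3 * b) / 4 <= lagrange_sup rho sigma by apply: inside; lra.
have t0 : 0 < t by rewrite /t; lra.
have tL : t < lagrange_sup rho sigma by rewrite /t; lra.
have /nbhs_ballP[d /= d0 hd] : nbhs A0 U by apply: open_nbhs_nbhs.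
have e0 : 0 < Num.min (d / 2) ((b - a) / 4).
  by rewrite lt_min !divr_gt0 // subr_gt0.
have [A []] := approx A0 t _ t0 tL e0.
rewrite !le_min => /andP[hA _] /andP[_ ht].
exists A; split.
  apply: hd; rewrite -ball_normE /= distrC (le_lt_trans hA) //.
  by rewrite ltr_pdivrMr // mulr2n mulrDr mulr1 ltrDl.
rewrite /= in_itv /=; move: ht; rewrite ler_norml /t => /andP[h3 h4].
by apply/andP; split; lra.
Qed.
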